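(* Let $\mathcal{B}=(\mathcal{O},\mathscr{C},\mathfrak{R},I,T)$ be an unambiguous bud generating system such that $\mathcal{O}$ is a locally finite operad and $\mathfrak{R}(1)$ finitely factorizes $\mathbf{Bud}_{\mathscr{C}}(\mathcal{O})$. Then the generating series $\mathbf{s}_{\mathrm{L}(\mathcal{B})}=\sum_{x\in\mathrm{L}(\mathcal{B})}t^{|x|}$ of the language of $\mathcal{B}$ is algebraic.
   Context: Colored operads. Let $\mathscr{C}$ be a finite set of colors. A $\mathscr{C}$-colored operad $\mathcal{C}=\bigsqcup_{n\geq1}\mathcal{C}(n)$ is a nonsymmetric colored set-operad: each $x\in\mathcal{C}(n)$ has arity $|x|=n$, an output color $\mathrm{out}(x)\in\mathscr{C}$ and a word of input colors $\mathrm{in}(x)\in\mathscr{C}^n$ with $i$-th letter $\mathrm{in}_i(x)$; $x\circ_i y\in\mathcal{C}(|x|+|y|-1)$ is defined iff $\mathrm{out}(y)=\mathrm{in}_i(x)$; there are units $\mathbf{1}_a\in\mathcal{C}(1)$, $a\in\mathscr{C}$, with output and input color $a$; the usual associativity and unit axioms hold. The complete composition is $x\circ[y_1,\dots,y_n]:=(\cdots((x\circ_n y_n)\circ_{n-1}y_{n-1})\cdots)\circ_1 y_1$ (defined when $\mathrm{out}(y_i)=\mathrm{in}_i(x)$ for all $i$). A (monochrome) operad is the case of a single color. $\mathcal{C}$ is locally finite if every $\mathcal{C}(n)$ is finite. Bud operads. For an operad $\mathcal{O}$ with unit $\mathbf{1}$, $\mathbf{Bud}_{\mathscr{C}}(\mathcal{O})$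 is the $\mathscr{C}$-colored operad of triples $(a,x,u)\in\mathscr{C}\times\mathcal{O}(n)\times\mathscr{C}^n$, $n\geq1$, with output color $a$, input colors $u$, units $\mathbf{1}_a=(a,\mathbf{1},a)$, and $(a,x,u)\circ_i(b,y,v)=(a,x\circ_i y,u')$ when $b=u_i$, where $u'$ is $u$ with its $i$-th letter replaced by $v$. A bud generating system is a tuple $\mathcal{B}=(\mathcal{O},\mathscr{C},\mathfrak{R},I,T)$ with $\mathcal{O}$ an operad, $\mathscr{C}$ a finite set of colors, $\mathfrak{R}$ a finite subset of $\mathbf{Bud}_{\mathscr{C}}(\mathcal{O})$ (rules) and $I,T\subseteq\mathscr{C}$. Write $x_1\to x_2$ if $x_2=x_1\circ_i r$ for some $r\in\mathfrak{R}$ and some $i$. The language $\mathrm{L}(\mathcal{B})$ is the set of all $x\in\mathbf{Bud}_{\mathscr{C}}(\mathcal{O})$ such that, for some $a\in I$, $x$ is obtained from $\mathbf{1}_a$ by a finite (possibly empty) sequence of steps $\to$, and all input colors of $x$ are in $T$. Finite factorization. For a subset $S$ of a $\mathscr{C}$-colored operad $\mathcal{C}$, $S(1)$ is the set of its elements of arity $1$, and $\mathbf{Free}(S)$ is the set of planar rooted trees whose internal nodes with $n\geq1$ children are labeled by arity-$n$ elements of $S$, such that if $v$ is the $i$-th child of $u$ (both internal) then the output color of the label of $v$ is the $i$-th input color of the label of $u$; it contains, for each color $a$, a tree consisting of one leaf with output and input color $a$. The evaluation $\mathrm{ev}_{\mathcal{C}}(\mathfrak{t})\in\mathcal{C}$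 is obtained by composing in $\mathcal{C}$ the labels along $\mathfrak{t}$ (the one-leaf tree of color $a$ evaluates to $\mathbf{1}_a$). $S$ finitely factorizes $\mathcal{C}$ if for each $x\in\mathcal{C}$ there are finitely many $\mathfrak{t}\in\mathbf{Free}(S)$ with $\mathrm{ev}_{\mathcal{C}}(\mathfrak{t})=x$. Series. $\mathbb{K}$ is a field of characteristic zero. A $\mathcal{C}$-series is a map $\mathbf{f}:\mathcal{C}\to\mathbb{K}$, with values denoted $\langle x,\mathbf{f}\rangle$. The characteristic series of a subset is its indicator function. $\mathbf{u}$ is the characteristic series of $\{\mathbf{1}_a:a\in\mathscr{C}\}$. Composition product: $\langle x,\mathbf{f}\odot\mathbf{g}\rangle:=\sum_{y,z_1,\dots,z_{|y|}\in\mathcal{C},\,x=y\circ[z_1,\dots,z_{|y|}]}\langle y,\mathbf{f}\rangle\prod_{i}\langle z_i,\mathbf{g}\rangle$; on a locally finite colored operad it is associative with unit $\mathbf{u}$. The $\odot$-inverse $\mathbf{f}^{\odot_{-1}}$ of $\mathbf{f}$, when it exists, is the unique series $\mathbf{x}$ with $\mathbf{f}\odot\mathbf{x}=\mathbf{u}=\mathbf{x}\odot\mathbf{f}$. Let $\mathbf{r}$, $\mathbf{i}$, $\mathbf{t}$ be the characteristic series of $\mathfrak{R}$, $\{\mathbf{1}_a:a\in I\}$, $\{\mathbf{1}_a:a\in T\}$ in $\mathbf{Bud}_{\mathscr{C}}(\mathcal{O})$. The syntactic generating series is $\mathrm{synt}(\mathcal{B}):=\mathbf{i}\odot(\mathbf{u}-\mathbf{r})^{\odot_{-1}}\odot\mathbf{t}$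 (well-defined when $\mathcal{O}$ is locally finite and $\mathfrak{R}(1)$ finitely factorizes $\mathbf{Bud}_{\mathscr{C}}(\mathcal{O})$). $\mathcal{B}$ is unambiguous if all coefficients of $\mathrm{synt}(\mathcal{B})$ are equal to $0$ or $1$. A formal power series in $t$ is algebraic if it is a root of a nonzero polynomial with coefficients polynomials in $t$. *)

(* Defs.v *)
From Stdlib Require Import Relation_Operators.
From HB Require Import structures.
From mathcomp Require Import all_boot all_algebra zify.
From mathcomp Require Import boolp classical_sets functions cardinality fsbigop.

Set Implicit Arguments.
Unset Strict Implicit.
Unset Printing Implicit Defensive.

Import GRing.Theory.

Local Open Scope classical_set_scope.
Local Open Scope ring_scope.

(* Positions are numbered from 0: position i below is position i + 1 in the
   usual operadic notation. *)

Definition splice (T : Type) (u : seq T) (i : nat) (v : seq T) : seq T :=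
  take i u ++ v ++ drop i.+1 u.

(* The arity is the length of the word of input colors.  Partial composition is
   a total function whose values are only meaningful (and only constrained)
   when [onth (op_in x) i = Some (op_out y)], that is, when i is a position of
   x whose input color is the output color of y. *)
Record coloredOperad (C : finType) := ColoredOperad {
  op_carrier :> choiceType;
  op_out : op_carrier -> C;
  op_in : op_carrier -> seq C;
  op_unit : C -> op_carrier;
  op_comp : op_carrier -> nat -> op_carrier -> op_carrier;
  op_in_gt0 : forall x, (0 < size (op_in x))%N;
  op_out_unit : forall a, op_out (op_unit a) = a;
  op_in_unit : forall a, op_in (op_unit a) = [:: a];
  op_out_comp : forall x i y, onth (op_in x) i = Some (op_out y) ->
    op_out (op_comp x i y) = op_out x;
  op_in_comp : forall x i y, onth (op_in x) i = Some (op_out y) ->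
    op_in (op_comp x i y) = splice (op_in x) i (op_in y);
  op_comp_seqA : forall x i y j z,
    onth (op_in x) i = Some (op_out y) -> onth (op_in y) j = Some (op_out z) ->
    op_comp (op_comp x i y) (i + j) z = op_comp x i (op_comp y j z);
  op_comp_parA : forall x i y j z, (i < j)%N ->
    onth (op_in x) i = Some (op_out y) -> onth (op_in x) j = Some (op_out z) ->
    op_comp (op_comp x i y) (j + size (op_in y)).-1 z
    = op_comp (op_comp x j z) i y;
  op_comp1x : forall x, op_comp (op_unit (op_out x)) 0 x = x;
  op_compx1 : forall x i a, onth (op_in x) i = Some a ->
    op_comp x i (op_unit a) = x
}.

Notation operad := (coloredOperad unit).

Section ColoredOperads.
Variables (C : finType) (O : coloredOperad C).

Definition arity (x : O) : nat := size (op_in x).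

Definition composable (x : O) (i : nat) (y : O) : Prop :=
  onth (op_in x) i = Some (op_out y).

Definition locally_finite : Prop :=
  forall n : nat, finite_set [set x : O | arity x = n].

(* (... ((x o_{i+n} y_n) o_{i+n-1} y_{n-1}) ...) o_i y_0 *)
Fixpoint full_comp_from (x : O) (i : nat) (ys : seq O) : O :=
  if ys is y :: ys' then op_comp (full_comp_from x i.+1 ys') i y else x.

Definition full_comp (x : O) (ys : seq O) : O := full_comp_from x 0 ys.

Definition full_composable (x : O) (ys : seq O) : Prop :=
  map (@op_out C O) ys = op_in x.

(* Leaves carry their color; in a tree of [Free S] with an internal node this
   color is determined by the parent of the leaf. *)
Inductive tree : Type :=
| Leaf of C
| Node of O & seq tree.

Definition tree_out (t : tree) : C :=
  match t with Leaf a => a | Node x _ => op_out x end.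

Inductive Free (S : set O) : tree -> Prop :=
| Free_leaf a : Free S (Leaf a)
| Free_node x ts : S x -> map tree_out ts = op_in x ->
    (forall t, List.In t ts -> Free S t) -> Free S (Node x ts).

Fixpoint ev (t : tree) : O :=
  match t with
  | Leaf a => op_unit O a
  | Node x ts => full_comp x (map ev ts)
  end.

Definition finitely_factorizes (S : set O) : Prop :=
  forall x : O, finite_set [set t | Free S t /\ ev t = x].

Section Series.
Variable K : fieldType.

Definition char_series (S : set O) : O -> K := fun x => (x \in S)%:R.

Definition unit_series : O -> K := char_series (range (op_unit O)).

(* A finitely supported sum: on a locally finite operad only finitely many
   pairs (y, [:: z_1; ...; z_|y|]) compose to x. *)
Definition comp_prod (f g : O -> K) : O -> K := fun x =>
  \sum_(p \in [set p : O * seq O |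
                 full_composable p.1 p.2 /\ x = full_comp p.1 p.2])
    (f p.1 * \prod_(z <- p.2) g z).

(* The zero series when f has no inverse. *)
Definition comp_inv (f : O -> K) : O -> K :=
  xget (fun _ => 0)
    [set g | comp_prod f g = unit_series /\ comp_prod g f = unit_series].

End Series.

End ColoredOperads.

Section Splice.
Variable T : Type.
Implicit Types u v w : seq T.

Lemma size_splice u i v : (i < size u)%N ->
  size (splice u i v) = (size u + size v).-1.
Proof.
by move=> lt_iu; rewrite /splice !size_cat size_drop size_take lt_iu; lia.
Qed.

Lemma onth_split u i b : onth u i = Some b ->
  exists u1 u2, u = u1 ++ b :: u2 /\ i = size u1.
Proof.
elim: u i => [|a u IH] [|i] //= => [[->]|/IH[u1 [u2 [-> ->]]]].
  by exists [::], u.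
by exists (a :: u1), u2.
Qed.

Lemma splice_cat u1 b u2 v i : i = size u1 ->
  splice (u1 ++ b :: u2) i v = u1 ++ v ++ u2.
Proof.
move=> ->.
by rewrite /splice take_size_cat // -cat_rcons drop_size_cat // size_rcons.
Qed.

Lemma splice_seqA u i v j w b c :
  onth u i = Some b -> onth v j = Some c ->
  splice (splice u i v) (i + j) w = splice u i (splice v j w).
Proof.
move=> /onth_split[u1 [u2 [-> ->]]] /onth_split[v1 [v2 [-> ->]]].
rewrite !splice_cat // -!catA /= catA splice_cat ?size_cat //.
by rewrite -!catA.
Qed.

Lemma splice_parA u i v j w b c : (i < j)%N -> (0 < size v)%N ->
  onth u i = Some b -> onth u j = Some c ->
  splice (splice u i v) (j + size v).-1 w = splice (splice u j w) i v.
Proof.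
move=> lt_ij v_gt0 /onth_split[u1 [u2 [-> ei]]].
rewrite onth_cat ifN -?leqNgt -?ei; last by lia.
case ej: (j - i)%N => [|k]; first by lia.
move=> /= /onth_split[u3 [u4 [-> ek]]].
rewrite splice_cat //.
have -> : u1 ++ v ++ u3 ++ c :: u4 = (u1 ++ v ++ u3) ++ c :: u4.
  by rewrite -!catA.
have -> : u1 ++ b :: u3 ++ c :: u4 = (u1 ++ b :: u3) ++ c :: u4.
  by rewrite -!catA.
rewrite !splice_cat ?size_cat /=; try by lia.
by rewrite -!catA /= splice_cat.
Qed.

End Splice.

Section Bud.
Variables (C : finType) (O : operad).

Definition bud_elt : Type :=
  {p : C * O * seq C | size p.2 == arity p.1.2}.

HB.instance Definition _ := Choice.on bud_elt.

Definition bud_out (p : bud_elt) : C := (val p).1.1.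
Definition bud_op (p : bud_elt) : O := (val p).1.2.
Definition bud_in (p : bud_elt) : seq C := (val p).2.

Lemma bud_eqP (p q : bud_elt) : bud_out p = bud_out q ->
  bud_op p = bud_op q -> bud_in p = bud_in q -> p = q.
Proof.
rewrite /bud_out /bud_op /bud_in => e1 e2 e3; apply: val_inj.
by move: e1 e2 e3; case: (val p) (val q) => [[a x] u] [[b y] v] /= -> -> ->.
Qed.

Lemma size_bud_in (p : bud_elt) : size (bud_in p) = arity (bud_op p).
Proof. exact: (eqP (valP p)). Qed.

Lemma bud_unit_subproof (a : C) :
  size [:: a] == arity (op_unit O tt).
Proof. by rewrite /arity op_in_unit. Qed.

Definition bud_unit (a : C) : bud_elt :=
  exist _ (a, op_unit O tt, [:: a]) (bud_unit_subproof a).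

(* The default value p is only taken when i is not a position of p. *)
Definition bud_comp (p : bud_elt) (i : nat) (q : bud_elt) : bud_elt :=
  insubd p (bud_out p, op_comp (bud_op p) i (bud_op q),
            splice (bud_in p) i (bud_in q)).

Lemma onth_unit (x y : O) i :
  (i < arity x)%N -> onth (op_in x) i = Some (op_out y).
Proof.
rewrite /arity -onthTE; case: (onth _ _) => // [[]] _.
by case: (op_out y).
Qed.

Lemma bud_onth p i b (y : O) : onth (bud_in p) i = Some b ->
  onth (op_in (bud_op p)) i = Some (op_out y).
Proof.
move=> pi; apply: onth_unit.
by rewrite -size_bud_in -onthTE pi.
Qed.

Lemma val_bud_comp p i q b : onth (bud_in p) i = Some b ->
  val (bud_comp p i q) = (bud_out p, op_comp (bud_op p) i (bud_op q),
                          splice (bud_in p) i (bud_in q)).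
Proof.
move=> pi; have lt_ip : (i < size (bud_in p))%N by rewrite -onthTE pi.
rewrite /bud_comp val_insubd ifT //=.
rewrite /arity op_in_comp; last exact: bud_onth pi.
by rewrite !size_splice ?size_bud_in -?/(arity _) -?size_bud_in.
Qed.

Lemma bud_out_comp p i q b : onth (bud_in p) i = Some b ->
  bud_out (bud_comp p i q) = bud_out p.
Proof. by move=> pi; rewrite {1}/bud_out (val_bud_comp _ pi). Qed.

Lemma bud_op_comp p i q b : onth (bud_in p) i = Some b ->
  bud_op (bud_comp p i q) = op_comp (bud_op p) i (bud_op q).
Proof. by move=> pi; rewrite {1}/bud_op (val_bud_comp _ pi). Qed.

Lemma bud_in_comp p i q b : onth (bud_in p) i = Some b ->
  bud_in (bud_comp p i q) = splice (bud_in p) i (bud_in q).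
Proof. by move=> pi; rewrite {1}/bud_in (val_bud_comp _ pi). Qed.

Lemma onth_splice_seq (u v : seq C) i j b c : onth u i = Some b ->
  onth v j = Some c -> onth (splice u i v) (i + j) = Some c.
Proof.
move=> /(@onth_split C)[u1 [u2 [-> ->]]] /(@onth_split C)[v1 [v2 [-> ->]]].
rewrite splice_cat // onth_cat ifN; last by lia.
rewrite addKn -catA onth_cat ifN ?ltnn //.
by rewrite subnn.
Qed.

Lemma onth_splice_parl (u v : seq C) i j b c : (i < j)%N ->
  onth u i = Some b -> onth u j = Some c -> onth (splice u j v) i = Some b.
Proof.
move=> lt_ij ui /(@onth_split C)[u1 [u2 [eu ej]]].
move: ui; rewrite eu splice_cat // !onth_cat.
by rewrite -ej lt_ij.
Qed.

Lemma onth_splice_parr (u v : seq C) i j b c : (i < j)%N -> (0 < size v)%N ->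
  onth u i = Some b -> onth u j = Some c ->
  onth (splice u i v) (j + size v).-1 = Some c.
Proof.
move=> lt_ij v_gt0 /(@onth_split C)[u1 [u2 [-> ei]]].
rewrite splice_cat // !onth_cat -ei !ifN; try by lia.
have -> : (j - i = (j - i).-1.+1)%N by lia.
move=> /= <-; congr onth; lia.
Qed.

Lemma bud_in_gt0 (p : bud_elt) : (0 < size (bud_in p))%N.
Proof. by rewrite size_bud_in; apply: op_in_gt0. Qed.

Lemma bud_comp_seqA p i q j r :
  onth (bud_in p) i = Some (bud_out q) ->
  onth (bud_in q) j = Some (bud_out r) ->
  bud_comp (bud_comp p i q) (i + j) r = bud_comp p i (bud_comp q j r).
Proof.
move=> pi qj.
have pqj : onth (bud_in (bud_comp p i q)) (i + j) = Some (bud_out r).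
  by rewrite (bud_in_comp _ pi) (onth_splice_seq pi qj).
apply: bud_eqP.
- by rewrite (bud_out_comp _ pqj) !(bud_out_comp _ pi).
- rewrite (bud_op_comp _ pqj) !(bud_op_comp _ pi) (bud_op_comp _ qj).
  by apply: op_comp_seqA; [apply: bud_onth pi | apply: bud_onth qj].
rewrite (bud_in_comp _ pqj) !(bud_in_comp _ pi) (bud_in_comp _ qj).
exact: splice_seqA pi qj.
Qed.

Lemma bud_comp_parA p i q j r : (i < j)%N ->
  onth (bud_in p) i = Some (bud_out q) ->
  onth (bud_in p) j = Some (bud_out r) ->
  bud_comp (bud_comp p i q) (j + size (bud_in q)).-1 r
  = bud_comp (bud_comp p j r) i q.
Proof.
move=> lt_ij pi pj.
have pqj : onth (bud_in (bud_comp p i q)) (j + size (bud_in q)).-1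
           = Some (bud_out r).
  by rewrite (bud_in_comp _ pi) (onth_splice_parr lt_ij _ pi pj) ?bud_in_gt0.
have pri : onth (bud_in (bud_comp p j r)) i = Some (bud_out q).
  by rewrite (bud_in_comp _ pj) (onth_splice_parl _ lt_ij pi pj).
apply: bud_eqP.
- by rewrite (bud_out_comp _ pqj) (bud_out_comp _ pi) (bud_out_comp _ pri)
             (bud_out_comp _ pj).
- rewrite (bud_op_comp _ pqj) (bud_op_comp _ pi) (bud_op_comp _ pri)
          (bud_op_comp _ pj) size_bud_in.
  by apply: op_comp_parA => //; [apply: bud_onth pi | apply: bud_onth pj].
rewrite (bud_in_comp _ pqj) (bud_in_comp _ pi) (bud_in_comp _ pri)
        (bud_in_comp _ pj).
by apply: splice_parA pi pj => //; apply: bud_in_gt0.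
Qed.

Lemma bud_comp1x p : bud_comp (bud_unit (bud_out p)) 0 p = p.
Proof.
have u0 : onth (bud_in (bud_unit (bud_out p))) 0 = Some (bud_out p) by [].
apply: bud_eqP.
- by rewrite (bud_out_comp _ u0).
- rewrite (bud_op_comp _ u0) /bud_op /=.
  by have := op_comp1x (val p).1.2; case: (op_out _).
by rewrite (bud_in_comp _ u0) /splice /= cats0.
Qed.

Lemma bud_compx1 p i a : onth (bud_in p) i = Some a ->
  bud_comp p i (bud_unit a) = p.
Proof.
move=> pi; apply: bud_eqP.
- by rewrite (bud_out_comp _ pi).
- rewrite (bud_op_comp _ pi) op_compx1 //.
  by rewrite (bud_onth (op_unit O tt) pi) op_out_unit.
rewrite (bud_in_comp _ pi) /=.
by have [u1 [u2 [-> ei]]] := onth_split pi; rewrite splice_cat.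
Qed.

Definition Bud : coloredOperad C :=
  @ColoredOperad C bud_elt bud_out bud_in bud_unit bud_comp
    bud_in_gt0 (fun _ => erefl) (fun _ => erefl)
    (fun p i q pi => bud_out_comp q pi) (fun p i q pi => bud_in_comp q pi)
    bud_comp_seqA bud_comp_parA bud_comp1x bud_compx1.

End Bud.

Record budGeneratingSystem (O : operad) (C : finType) := BudGeneratingSystem {
  rules : set (Bud C O);
  rules_finite : finite_set rules;
  initial_colors : set C;
  terminal_colors : set C
}.

Section BudGeneratingSystems.
Variables (O : operad) (C : finType) (B : budGeneratingSystem O C).

Definition unary_rules : set (Bud C O) := [set r | rules B r /\ arity r = 1%N].

Definition derives (x1 x2 : Bud C O) : Prop :=
  exists r i, [/\ rules B r, composable x1 i r & x2 = op_comp x1 i r].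

Definition language : set (Bud C O) :=
  [set x | (exists2 a, initial_colors B a &
              clos_refl_trans _ derives (op_unit (Bud C O) a) x)
           /\ forall c, c \in op_in x -> terminal_colors B c].

Variable K : fieldType.

Definition rules_series : Bud C O -> K := char_series K (rules B).

Definition initial_series : Bud C O -> K :=
  char_series K (op_unit (Bud C O) @` initial_colors B).

Definition terminal_series : Bud C O -> K :=
  char_series K (op_unit (Bud C O) @` terminal_colors B).

Definition synt : Bud C O -> K :=
  comp_prod
    (comp_prod initial_series
       (comp_inv (unit_series K \- rules_series)))
    terminal_series.

Definition unambiguous : Prop := forall x, synt x = 0 \/ synt x = 1.

End BudGeneratingSystems.

(* K[[t]]: the n-th coefficient of f is f n. *)
Definition powerSeries (K : fieldType) : Type := nat -> K.

Section PowerSeries.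
Variable K : fieldType.
Implicit Types f g h : powerSeries K.

HB.instance Definition _ := GRing.Zmodule.copy (powerSeries K) (nat -> K).

Definition ps_one : powerSeries K := fun n => (n == 0%N)%:R.

Definition ps_mul f g : powerSeries K :=
  fun n => \sum_(i < n.+1) f i * g (n - i)%N.

Definition ps_trunc n f : {poly K} := \poly_(i < n) f i.

Lemma ps_mulE n f g m : (m < n)%N ->
  ps_mul f g m = (ps_trunc n f * ps_trunc n g)`_m.
Proof.
move=> lt_mn; rewrite coefM; apply: eq_bigr => i _.
by rewrite !coef_poly !ifT //; have := ltn_ord i; lia.
Qed.

Lemma coef_mul_trunc n (p q p' q' : {poly K}) m : (m < n)%N ->
  (forall k, (k < n)%N -> p`_k = p'`_k) ->
  (forall k, (k < n)%N -> q`_k = q'`_k) -> (p * q)`_m = (p' * q')`_m.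
Proof.
move=> lt_mn ep eq; rewrite !coefM; apply: eq_bigr => i _.
by rewrite ep ?eq //; have := ltn_ord i; lia.
Qed.

Lemma coef_trunc n f k : (k < n)%N -> (ps_trunc n f)`_k = f k.
Proof. by move=> lt_kn; rewrite coef_poly lt_kn. Qed.

Lemma ps_mulA : associative ps_mul.
Proof.
move=> f g h; apply/funext => m.
rewrite !(ps_mulE _ _ (ltnSn m)).
transitivity ((ps_trunc m.+1 f * (ps_trunc m.+1 g * ps_trunc m.+1 h))`_m).
  apply: (coef_mul_trunc (ltnSn m)) => // k lt_km.
  by rewrite coef_trunc // (ps_mulE _ _ lt_km).
rewrite mulrA; apply: (coef_mul_trunc (ltnSn m)) => // k lt_km.
by rewrite coef_trunc // (ps_mulE _ _ lt_km).
Qed.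

Lemma ps_mulC : commutative ps_mul.
Proof.
by move=> f g; apply/funext => m; rewrite !(ps_mulE _ _ (ltnSn m)) mulrC.
Qed.

Lemma ps_mul1f : left_id ps_one ps_mul.
Proof.
move=> f; apply/funext => m.
rewrite /ps_mul big_ord_recl /= /ps_one eqxx mul1r subn0 big1 ?addr0 // => i _.
by rewrite /= mul0r.
Qed.

Lemma ps_mulDl : left_distributive ps_mul +%R.
Proof.
move=> f g h; apply/funext => m; rewrite /ps_mul /= -[RHS]big_split /=.
by apply: eq_bigr => i _; rewrite mulrDl.
Qed.

Lemma ps_one_neq0 : ps_one != 0.
Proof.
apply/eqP => /(congr1 (fun f : powerSeries K => f 0%N)) /eqP.
by rewrite /ps_one /= oner_eq0.
Qed.

HB.instance Definition _ := GRing.Zmodule_isComNzRing.Build (powerSeries K)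
  ps_mulA ps_mulC ps_mul1f ps_mulDl ps_one_neq0.

Definition ps_of_poly (p : {poly K}) : powerSeries K := fun n => p`_n.

Definition algebraic_ps f : Prop :=
  exists2 P : {poly {poly K}}, P != 0 & root (map_poly ps_of_poly P) f.

End PowerSeries.

(* sum_(x in S) t^|x| *)
Definition generating_series (K : fieldType) (C : finType) (O : coloredOperad C)
    (S : set O) : powerSeries K :=
  fun n => \sum_(x \in S) ((arity x == n)%:R : K).

(* Main.v *)
Require Import Defs.
From Stdlib Require Import Relation_Operators.
From HB Require Import structures.
From mathcomp Require Import all_boot all_algebra zify ring.
From mathcomp Require Import boolp classical_sets functions cardinality fsbigop.

Set Implicit Arguments.
Unset Strict Implicit.
Unset Printing Implicit Defensive.

Import GRing.Theory.

Local Open Scope classical_set_scope.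
Local Open Scope ring_scope.

(** Let r be the indicator of the rules, and let X be the series counting the
    derivation trees over the rules that evaluate to a given element.  It is
    the solution of X = u + r o X for the composition product o.  Finite
    factorization by the unary rules forbids cycles of unary rules, so the
    colors carry a rank that every unary rule decreases from its output to its
    input ([unary_rank_exists]); hence on any element x the value of r o f only
    involves the values of f on elements of smaller weight, where the weight
    combines the arity and the rank of the output color.  Equations
    f = c + r o f therefore have exactly one solution.  This produces X and,
    with the associativity of the composition product ([comp_prodA]), shows
    that X is the two-sided inverse of u - r ([comp_inv_tree_series]).  Thus
    synt(x) is X(x) if the colors of x are admissible and 0 otherwise.  The
    values of X are natural numbers, positive exactly on the elements generated
    by the rules ([tree_series_counts]), so in characteristic zero the
    unambiguity says that synt is the indicator of the language.

    Let F_a(t) be the sum of X(x) t^|x| over the x with output color a and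
    terminal inputs.  Then F_a = [a in T] t + sum_r prod_i F_(in_i r), the sum
    running over the rules r with output a ([color_gf_system]), and the
    generating series of the language is the sum of the F_a over the initial
    colors a.

    That the solution of such a system is algebraic ([algebraic_system]) is
    proved by a perturbation.  Add s F_a^N to the equation of F_a, with a new
    variable s and N larger than all arities.  The perturbed system still has
    a solution y, in K[s][[t]].  Now s y_a^N is a combination of monomials in y
    of degree less than N, so up to powers of s every monomial reduces to the
    finitely many monomials with all exponents below N: the y_a generate a
    finite-dimensional algebra over K(s,t), and every element z of that algebra
    is a root of a nonzero polynomial Q over K[s,t] ([perturbed_algebraic]).
    Dividing Q by the largest possible power of s and then putting s = 0 gives
    a nonzero polynomial over K[t] vanishing at z(s = 0)
    ([specialization_algebraic]), and y(s = 0) = F by uniqueness. *)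

(** * Recursion along a rank *)

Section RankedRecursion.
Variables (E V : Type) (mu : E -> nat) (Phi : (E -> V) -> E -> V).

(** The value of [Phi f] at [e] only depends on the values of [f] at elements
    of smaller rank. *)
Definition ranked :=
  forall e f g, (forall e', (mu e' < mu e)%N -> f e' = g e') ->
    Phi f e = Phi g e.

Hypothesis Phi_ranked : ranked.

Lemma ranked_fixpoint_unique f g : Phi f =1 f -> Phi g =1 g -> f =1 g.
Proof.
move=> fixf fixg e; elim/ltn_ind: {e}(mu e) {-2}e (leqnn (mu e)) => n IH e le_en.
rewrite -fixf -fixg; apply: Phi_ranked => e' lt_e'.
by apply: (IH (mu e')) => //; apply: leq_trans le_en.
Qed.

Lemma ranked_fixpoint_exists (v0 : V) : exists f, Phi f =1 f.
Proof.
pose it k := iter k Phi (fun=> v0).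
(* the value of the k-th iterate at e no longer changes once k > mu e *)
have itE k e : (mu e < k)%N -> it k e = it (mu e).+1 e.
  have [n] := ubnP (mu e); elim: n e k => // n IH e [|k] // lt_en lt_ek.
  apply: Phi_ranked => e' lt_e'.
  transitivity (it (mu e').+1 e'); first by apply: IH; lia.
  by symmetry; apply: IH; lia.
exists (fun e => it (mu e).+1 e) => e.
by apply: Phi_ranked => e' lt_e'; rewrite [RHS]itE.
Qed.

End RankedRecursion.

(** * Formal power series over a commutative ring *)

Section FormalPowerSeries.
Variable R : comNzRingType.

(** R[[t]]: the n-th coefficient of [f] is [f n].  The coefficients range over
    a commutative ring, and not only over a field as in [powerSeries], because
    K[s][[t]] is needed. *)
Definition fps : Type := nat -> R.

Implicit Types f g h : fps.

HB.instance Definition _ := GRing.Zmodule.copy fps (nat -> R).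

Definition fps_one : fps := fun n => (n == 0%N)%:R.

Definition fps_mul f g : fps := fun n => \sum_(i < n.+1) f i * g (n - i)%N.

Fact fps_mul_coef n f g m : (m <= n)%N ->
  fps_mul f g m = ((\poly_(i < n.+1) f i) * (\poly_(i < n.+1) g i))`_m.
Proof.
move=> le_mn; rewrite coefM; apply: eq_bigr => i _.
by rewrite !coef_poly !ifT //; have := ltn_ord i; lia.
Qed.

Fact eq_coefM (p q p' q' : {poly R}) m :
  (forall k, (k <= m)%N -> p`_k = p'`_k) ->
  (forall k, (k <= m)%N -> q`_k = q'`_k) -> (p * q)`_m = (p' * q')`_m.
Proof.
move=> ep eq; rewrite !coefM; apply: eq_bigr => i _.
by rewrite ep ?eq //; have := ltn_ord i; lia.
Qed.

Fact fps_mulA : associative fps_mul.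
Proof.
move=> f g h; apply/funext => m; rewrite !(fps_mul_coef _ _ (leqnn m)).
pose tr f := \poly_(i < m.+1) f i.
transitivity ((tr f * (tr g * tr h))`_m).
  apply: eq_coefM => // k le_km.
  by rewrite coef_poly ltnS le_km (fps_mul_coef _ _ le_km).
rewrite mulrA; apply: eq_coefM => // k le_km.
by rewrite coef_poly ltnS le_km (fps_mul_coef _ _ le_km).
Qed.

Fact fps_mulC : commutative fps_mul.
Proof.
by move=> f g; apply/funext => m; rewrite !(fps_mul_coef _ _ (leqnn m)) mulrC.
Qed.

Fact fps_mul1f : left_id fps_one fps_mul.
Proof.
move=> f; apply/funext => m.
by rewrite /fps_mul big_ord_recl /= mul1r subn0 big1 ?addr0 // => i; rewrite mul0r.
Qed.

Fact fps_mulDl : left_distributive fps_mul +%R.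
Proof.
move=> f g h; apply/funext => m; rewrite /fps_mul -[RHS]big_split /=.
by apply: eq_bigr => i _; rewrite mulrDl.
Qed.

Fact fps_one_neq0 : fps_one != 0.
Proof. by apply/eqP => /(congr1 (@^~ 0%N)) /eqP; rewrite oner_eq0. Qed.

HB.instance Definition _ := GRing.Zmodule_isComNzRing.Build fps
  fps_mulA fps_mulC fps_mul1f fps_mulDl fps_one_neq0.

Lemma fpsM f g n : (f * g) n = \sum_(i < n.+1) f i * g (n - i)%N.
Proof. by []. Qed.

Lemma fps_sum I (r : seq I) (P : pred I) (F : I -> fps) n :
  (\sum_(i <- r | P i) F i) n = \sum_(i <- r | P i) F i n.
Proof. exact: (big_morph (fun f : fps => f n)). Qed.

Definition fps_of_poly (p : {poly R}) : fps := fun n => p`_n.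

Fact fps_of_poly_additive : zmod_morphism fps_of_poly.
Proof. by move=> p q; apply/funext => n; rewrite /fps_of_poly coefB. Qed.

Fact fps_of_poly_multiplicative : monoid_morphism fps_of_poly.
Proof.
split; first by apply/funext => n; rewrite /fps_of_poly coef1.
by move=> p q; apply/funext => n; rewrite /fps_of_poly coefM.
Qed.

HB.instance Definition _ :=
  GRing.isZmodMorphism.Build _ _ fps_of_poly fps_of_poly_additive.
HB.instance Definition _ :=
  GRing.isMonoidMorphism.Build _ _ fps_of_poly fps_of_poly_multiplicative.

Lemma fps_polyCM (c : R) f n : (fps_of_poly c%:P * f) n = c * f n.
Proof.
rewrite fpsM big_ord_recl /fps_of_poly /= coefC subn0 big1 ?addr0 // => i _.
by rewrite coefC mul0r.
Qed.

End FormalPowerSeries.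

(** Change of coefficients along a ring morphism. *)
Section FpsMap.
Variables (R S : comNzRingType) (g : {rmorphism R -> S}).

Definition fps_map (f : fps R) : fps S := fun n => g (f n).

Fact fps_map_additive : zmod_morphism fps_map.
Proof. by move=> f h; apply/funext => n; apply: rmorphB. Qed.

Fact fps_map_multiplicative : monoid_morphism fps_map.
Proof.
split; first by apply/funext => n; rewrite /fps_map rmorph_nat.
move=> f h; apply/funext => n; rewrite /fps_map fpsM rmorph_sum fpsM.
by apply: eq_bigr => i _; rewrite rmorphM.
Qed.

HB.instance Definition _ :=
  GRing.isZmodMorphism.Build _ _ fps_map fps_map_additive.
HB.instance Definition _ :=
  GRing.isMonoidMorphism.Build _ _ fps_map fps_map_multiplicative.

Lemma fps_map_poly p : fps_map (fps_of_poly p) = fps_of_poly (map_poly g p).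
Proof. by apply/funext => n; rewrite /fps_map /fps_of_poly coef_map. Qed.

End FpsMap.

(** * Polynomial systems *)

Section System.
Variables (R : comNzRingType) (C : finType).
Implicit Types (y f g : C -> fps R) (rl : seq (R * (C * seq C))).

(** The right-hand side at [y] of the equation
    y_a = [a in T] t + sum_(c, (a, w)) c prod_(b in w) y_b;
    a rule [(c, (a, w))] has weight [c], output color [a], input word [w]. *)
Definition system rl (T : pred C) y (a : C) : fps R :=
  fps_of_poly ((T a)%:R *: 'X)
  + \sum_(q <- rl | q.2.1 == a)
      fps_of_poly q.1%:P * \prod_(b <- q.2.2) y b.

Lemma eq_coef_prod f g (w : seq C) m :
  (forall b n, (n < m)%N -> f b n = g b n) ->
  forall n, (n < m)%N -> (\prod_(b <- w) f b) n = (\prod_(b <- w) g b) n.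
Proof.
move=> eq_fg; elim: w => [|b w IH] n lt_nm; first by rewrite !big_nil.
rewrite !big_cons !fpsM; apply: eq_bigr => i _.
by have := ltn_ord i => lt_i; rewrite IH ?eq_fg //; lia.
Qed.

Lemma coef0_prod f b (w : seq C) : (forall b, f b 0%N = 0) ->
  (\prod_(c <- b :: w) f c) 0%N = 0.
Proof. by move=> f0; rewrite big_cons fpsM big_ord1 f0 mul0r. Qed.

(** Since the constant terms vanish, the coefficient of degree [m] of a product
    of at least two factors only involves degrees below [m]. *)
Lemma eq_coef_prod2 f g b c (w : seq C) m :
  (forall b, f b 0%N = 0) -> (forall b, g b 0%N = 0) ->
  (forall b n, (n < m)%N -> f b n = g b n) ->
  (\prod_(d <- [:: b, c & w]) f d) m = (\prod_(d <- [:: b, c & w]) g d) m.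
Proof.
move=> f0 g0 eq_fg; rewrite ![\prod_(d <- b :: _) _]big_cons !fpsM.
apply: eq_bigr => i _; case: (posnP i) => [->|i_gt0]; first by rewrite f0 g0 !mul0r.
have := ltn_ord i; rewrite ltnS leq_eqVlt => /orP[/eqP ->|lt_im].
  by rewrite subnn !coef0_prod // !mulr0.
by rewrite eq_fg // (eq_coef_prod _ eq_fg) //; lia.
Qed.

Variables (rl : seq (R * (C * seq C))) (T : pred C) (rk : C -> nat).

(** No rule has an empty input word, and unary rules decrease the rank [rk]:
    together these make the system solvable coefficient by coefficient. *)
Definition graded_rules :=
  forall q, q \in rl ->
    q.2.2 != [::] /\ forall b, q.2.2 = [:: b] -> (rk b < rk q.2.1)%N.

Hypothesis rl_graded : graded_rules.

(* Forcing the constant terms to be 0 makes the recursion below ranked for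
   all f, and not only for those with zero constant terms. *)
Let kill0 (f : nat * C -> R) : C -> fps R :=
  fun b n => if n == 0%N then 0 else f (n, b).

Let Phi (f : nat * C -> R) (e : nat * C) : R := system rl T (kill0 f) e.2 e.1.

(* lexicographic in the degree and the rank of the color *)
Let mu (e : nat * C) : nat := (e.1 * (\max_b rk b).+1 + rk e.2)%N.

Let Phi_ranked : ranked mu Phi.
Proof.
move=> [m a] f g eq_fg; rewrite /Phi /system /=.
congr (_ + _); rewrite !fps_sum big_seq_cond [RHS]big_seq_cond.
apply: eq_bigr => -[c [a' w]] /= /andP[/rl_graded[/= w0 w1] /eqP ea].
rewrite !fps_polyCM; congr (_ * _).
case: w w0 w1 => [|b [|b' w]] // _ w1.
  rewrite !big_seq1 /kill0; case: eqP => // _; apply: eq_fg.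
  by have := w1 _ erefl; rewrite -ea /mu /=; lia.
apply: eq_coef_prod2 => // d n lt_nm; rewrite /kill0; case: eqP => // _.
apply: eq_fg; rewrite /mu /=.
by have := leq_bigmax (F := rk) d; nia.
Qed.

Lemma system_coef0 y a : (forall b, y b 0%N = 0) -> system rl T y a 0%N = 0.
Proof.
move=> y0; rewrite /system -[LHS]/(_ 0%N + _ 0%N) fps_sum /fps_of_poly coefZ coefX.
rewrite mulr0 add0r big_seq_cond big1 // => -[c [a' w]] /andP[/rl_graded[/= w0 _] _].
rewrite -[LHS]/((fps_of_poly c%:P * _) 0%N) fps_polyCM.
by case: w w0 => // b w _; rewrite coef0_prod ?mulr0.
Qed.

Let kill0E y : (forall b, y b 0%N = 0) -> kill0 (fun e => y e.2 e.1) = y.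
Proof.
by move=> y0; apply/funext => b; apply/funext => -[|n] //; rewrite /kill0 /= y0.
Qed.

Lemma system_unique f g :
  (forall b, f b 0%N = 0) -> (forall b, g b 0%N = 0) ->
  system rl T f =1 f -> system rl T g =1 g -> f =1 g.
Proof.
move=> f0 g0 ef eg a; apply/funext => n.
have := ranked_fixpoint_unique Phi_ranked (f := fun e => f e.2 e.1)
  (g := fun e => g e.2 e.1) _ _ (n, a).
apply => e; rewrite /Phi kill0E //; first by rewrite ef.
by rewrite eg.
Qed.

Lemma system_exists :
  exists2 y, forall b, y b 0%N = 0 & system rl T y =1 y.
Proof.
have [f ef] := ranked_fixpoint_exists Phi_ranked 0.
have k0 b : kill0 f b 0%N = 0 by [].
have f0 b : f (0%N, b) = 0 by rewrite -ef /Phi system_coef0.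
have kf : kill0 f = fun b n => f (n, b).
  by apply/funext => b; apply/funext => -[|n] //; rewrite f0.
exists (kill0 f) => // a; apply/funext => n.
by rewrite [in RHS]kf -ef.
Qed.

End System.

(** * Algebraicity of the solutions *)

(** The rules [rl] and, for each color [a], a rule of weight [s] with [N] inputs
    of color [a]. *)
Definition perturbed_rules (R : comNzRingType) (C : finType)
    (rl : seq (R * (C * seq C))) (N : nat) (s : R) : seq (R * (C * seq C)) :=
  rl ++ [seq (s, (a, nseq N a)) | a <- enum C].

Section PerturbedSystem.
Variables (R : idomainType) (C : finType).
Variables (rl : seq (R * (C * seq C))) (T : pred C) (N : nat) (s : R).

Hypothesis N_gt1 : (1 < N)%N.
Hypothesis rl_small : forall q, q \in rl -> (size q.2.2 < N)%N.
Hypothesis s_neq0 : s != 0.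
Variable y : C -> fps R.
Hypothesis y_system : system (perturbed_rules rl N s) T y =1 y.

Local Notation phi := (@fps_of_poly R).
Local Notation mon ms := (\prod_(b <- ms) y b).

Lemma perturbed_systemE a :
  phi s%:P * y a ^+ N = y a - phi ((T a)%:R *: 'X)
    - \sum_(q <- rl | q.2.1 == a) phi q.1%:P * mon q.2.2.
Proof.
rewrite -{2}[y a]y_system /system big_cat big_map /=.
rewrite [X in _ + (_ + X)](_ : _ = phi s%:P * y a ^+ N); first by ring.
rewrite big_enum_cond (big_pred1 a) /=; last by move=> b; rewrite eq_sym.
by rewrite big_nseq -Monoid.iteropE.
Qed.

(* the monomials in y with all exponents below N *)
Let E := {ffun C -> 'I_N}.

Let m (e : E) : fps R := \prod_a y a ^+ e a.

(* z is a combination of these monomials with coefficients in R[t][1/s] *)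
Let spanned (z : fps R) : Prop :=
  exists k, exists c : E -> {poly R},
    phi (s%:P ^+ k) * z = \sum_e phi (c e) * m e.

Let spannedD z1 z2 : spanned z1 -> spanned z2 -> spanned (z1 + z2).
Proof.
move=> [k1 [c1 e1]] [k2 [c2 e2]]; exists (k1 + k2)%N.
exists (fun e => s%:P ^+ k2 * c1 e + s%:P ^+ k1 * c2 e).
have -> : phi (s%:P ^+ (k1 + k2)) * (z1 + z2) =
    phi (s%:P ^+ k2) * (phi (s%:P ^+ k1) * z1)
    + phi (s%:P ^+ k1) * (phi (s%:P ^+ k2) * z2).
  by rewrite exprD rmorphM /=; ring.
rewrite e1 e2 !mulr_sumr -big_split /=; apply: eq_bigr => e _.
by rewrite rmorphD !rmorphM /=; ring.
Qed.

Let spannedZ p z : spanned z -> spanned (phi p * z).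
Proof.
move=> [k [c e]]; exists k, (fun e => p * c e).
rewrite mulrCA e mulr_sumr; apply: eq_bigr => i _.
by rewrite rmorphM mulrA.
Qed.

Let spanned0 : spanned 0.
Proof.
exists 0%N, (fun=> 0); rewrite mulr0 big1 // => e _.
by rewrite rmorph0 mul0r.
Qed.

Let spanned_sum I (r : seq I) (P : pred I) (F : I -> fps R) :
  (forall i, P i -> spanned (F i)) -> spanned (\sum_(i <- r | P i) F i).
Proof. exact: big_ind. Qed.

Let spannedN z : spanned z -> spanned (- z).
Proof. by move=> /(spannedZ (-1)); rewrite rmorphN rmorph1 mulN1r. Qed.

Let spanned_divs z : spanned (phi s%:P * z) -> spanned z.
Proof.
move=> [k [c e]]; exists k.+1, c; rewrite -e.
by rewrite exprSr rmorphM mulrA.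
Qed.

(* If some exponent is at least N, the equation for s * y_a ^ N rewrites the
   monomial in terms of monomials of smaller degree. *)
Let spanned_mon ms : spanned (mon ms).
Proof.
have [n] := ubnP (size ms); elim: n ms => // n IH ms lt_msn.
have [/forallP small|] := boolP [forall a, (count_mem a ms < N)%N].
  pose e0 : E := [ffun a => Ordinal (small a)].
  have e0E a : e0 a = count_mem a ms :> nat by rewrite ffunE.
  exists 0%N, (fun e => (e == e0)%:R).
  rewrite expr0 rmorph1 mul1r (bigD1 e0) //= [X in _ + X]big1 => [|e /negPf ->].
    rewrite eqxx rmorph1 mul1r addr0 /m.
    transitivity (\prod_a y a ^+ count_mem a ms); last first.
      by apply: eq_bigr => a _; rewrite e0E.
    clear e0 e0E; elim: ms {IH lt_msn small} => [|b ms IHms].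
      by rewrite big_nil big1.
    rewrite big_cons IHms (bigD1 b) //= [RHS](bigD1 b) //= eqxx add1n exprS mulrA.
    congr (_ * _); apply: eq_bigr => c /negPf ncb.
    by rewrite eq_sym ncb.
  by rewrite rmorph0 mul0r.
rewrite negb_forall => /existsP[a]; rewrite -leqNgt => le_N.
have [ms' ems] : exists ms', perm_eq ms (nseq N a ++ ms').
  exists (nseq (count_mem a ms - N) a ++ filter (predC1 a) ms).
  have -> : filter (predC1 a) ms = filter (predC (pred1 a)) ms by [].
  rewrite catA -nseqD subnKC // -size_filter.
  have /all_pred1P <- : all (pred1 a) (filter (pred1 a) ms) by apply: filter_all.
  by rewrite perm_sym perm_filterC.
apply: spanned_divs; rewrite (perm_big _ ems) /= big_cat /= big_nseq.
rewrite -Monoid.iteropE mulrA -/(y a ^+ N) perturbed_systemE !mulrBl.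
have sms : size ms = (N + size ms')%N by rewrite (perm_size ems) size_cat size_nseq.
have lt_n : (N + size ms' <= n)%N by rewrite -ltnS -sms.
apply: spannedD; first apply: spannedD.
- have := IH (a :: ms'); rewrite big_cons; apply; apply: leq_trans lt_n.
  by rewrite /= -[(size ms').+1]add1n ltn_add2r.
- apply: spannedN; apply: spannedZ; apply: IH.
  by rewrite (leq_trans _ lt_n) // -add1n leq_add2r ltnW.
apply: spannedN; rewrite mulr_suml big_seq_cond.
apply: spanned_sum => q /andP[/rl_small lt_q _].
rewrite -mulrA -big_cat; apply: spannedZ; apply: IH.
by rewrite size_cat; apply: leq_trans lt_n; rewrite ltn_add2r.
Qed.

Let spanned_pow (I : pred C) j ms : spanned ((\sum_(a | I a) y a) ^+ j * mon ms).
Proof.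
elim: j ms => [|j IH] ms; first by rewrite mul1r.
rewrite exprSr -mulrA mulr_suml mulr_sumr; apply: spanned_sum => a _.
by have := IH (a :: ms); rewrite big_cons.
Qed.

Lemma perturbed_algebraic (I : pred C) :
  exists2 Q : {poly {poly R}}, Q != 0 &
    (map_poly phi Q).[\sum_(a | I a) y a] = 0.
Proof.
set z := \sum_(a | I a) y a.
pose D := #|{: E}|.
have /choice[k /choice[c ec]] : forall j : 'I_D.+1, spanned (z ^+ j).
  by move=> j; have := spanned_pow I j [::]; rewrite big_nil mulr1.
(* D + 1 powers of z are combinations of D monomials; the extra zero column
   (index ord_max) makes the matrix of coefficients square and singular. *)
pose M : 'M[{poly R}]_D.+1 :=
  \matrix_(i, j) if unlift ord_max j is Some j' then c i (enum_val j') else 0.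
have detM : \det M = 0.
  rewrite (expand_det_col M ord_max) big1 // => i _.
  by rewrite mxE unlift_none mul0r.
have [v v_neq0 vM] : exists2 v : 'rV_D.+1, v != 0 & v *m M = 0.
  by apply/det0P; rewrite detM.
exists (\poly_(i < D.+1) (v 0 (inord i) * s%:P ^+ k (inord i))).
  have /rV0Pn[j vj] := v_neq0.
  apply/eqP => /(congr1 (fun p : {poly {poly R}} => p`_j)); apply/eqP.
  rewrite coef0 coef_poly ltn_ord inord_val mulf_neq0 //.
  by rewrite expf_neq0 // polyC_eq0.
have -> : map_poly phi (\poly_(i < D.+1) (v 0 (inord i) * s%:P ^+ k (inord i))) =
   \poly_(i < D.+1) phi (v 0 (inord i) * s%:P ^+ k (inord i)).
  apply/polyP => i; rewrite coef_map !coef_poly.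
  by case: ifP => // _; exact: raddf0.
rewrite horner_poly.
under eq_bigr => i _ do rewrite inord_val rmorphM -mulrA ec mulr_sumr.
rewrite exchange_big /= big1 // => e _.
under eq_bigr => i _ do rewrite mulrA -rmorphM.
rewrite -mulr_suml -rmorph_sum.
suff -> : \sum_i v 0 i * c i e = 0 by rewrite raddf0 mul0r.
have /(congr1 (fun A : 'rV_D.+1 => A 0 (lift ord_max (enum_rank e)))) := vM.
rewrite [LHS]mxE [RHS]mxE => sum0; rewrite -[RHS]sum0.
by apply: eq_bigr => i _; rewrite mxE liftK enum_rankK.
Qed.

End PerturbedSystem.

Section Specialization.
Variable K : fieldType.

(** The identity map; it is a ring morphism between two presentations of
    K[[t]]. *)
Definition powerSeries_of_fps (f : fps K) : powerSeries K := f.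

Fact powerSeries_of_fps_additive : zmod_morphism powerSeries_of_fps.
Proof. by []. Qed.

Fact powerSeries_of_fps_multiplicative : monoid_morphism powerSeries_of_fps.
Proof. by []. Qed.

HB.instance Definition _ := GRing.isZmodMorphism.Build _ _
  powerSeries_of_fps powerSeries_of_fps_additive.
HB.instance Definition _ := GRing.isMonoidMorphism.Build _ _
  powerSeries_of_fps powerSeries_of_fps_multiplicative.

Local Notation ev0 := (horner_eval (0 : K)).
Local Notation phi := (@fps_of_poly {poly K}).

(** An annihilating polynomial of [z] over K[s][t] can be chosen nonzero at
    s = 0: as long as it vanishes there, divide it by s, the variable ['X] of
    the innermost polynomials.  The size of a fixed nonzero coefficient bounds
    the number of divisions. *)
Lemma divide_out_X (z : fps {poly K}) (Q : {poly {poly {poly K}}}) :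
  Q != 0 -> (map_poly phi Q).[z] = 0 ->
  exists2 Q' : {poly {poly {poly K}}},
    map_poly (map_poly ev0) Q' != 0 & (map_poly phi Q').[z] = 0.
Proof.
move=> Q0 Qz.
have [j Qj] : exists j, Q`_j != 0.
  by exists (size Q).-1; rewrite -lead_coefE lead_coef_eq0.
have [i Qji] : exists i, Q`_j`_i != 0.
  by exists (size Q`_j).-1; rewrite -lead_coefE lead_coef_eq0.
have [n] := ubnP (size Q`_j`_i).
elim: n Q Qz Qji {Q0 Qj} => // n IH Q Qz Qji lt_n.
have [ev_Q|] := eqVneq (map_poly (map_poly ev0) Q) 0; last by exists Q.
have Q_root k l : Q`_k`_l = drop_poly 1 Q`_k`_l * 'X.
  have := congr1 (fun p : {poly {poly K}} => p`_k`_l) ev_Q.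
  rewrite !coef_map !coef0 /= /horner_eval horner_coef0 => kl0.
  by apply/polyP => -[|m]; rewrite coefMX coef_drop_poly ?addn1.
pose Q1 : {poly {poly {poly K}}} :=
  \poly_(k < size Q) \poly_(l < size Q`_k) drop_poly 1 Q`_k`_l.
have Q1E k l : Q1`_k`_l = drop_poly 1 Q`_k`_l.
  rewrite coef_poly; case: ltnP => [_|le_k]; last first.
    by rewrite coef0 (nth_default _ le_k) coef0 raddf0.
  rewrite coef_poly; case: ltnP => // le_l.
  by rewrite (nth_default _ le_l) raddf0.
have QE : Q = ('X%:P)%:P * Q1.
  by apply/polyP => k; apply/polyP => l; rewrite !coefCM Q1E [LHS]Q_root mulrC.
apply: (IH Q1).
- apply/funext => m; have := congr1 (fun f => f m) Qz.
  rewrite /= QE rmorphM /= map_polyC hornerM hornerC fps_polyCM => /eqP.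
  by rewrite mulf_eq0 polyX_eq0 => /eqP.
- by apply: contraNneq Qji => Q10; rewrite Q_root -Q1E Q10 mul0r.
move: lt_n; rewrite Q_root -Q1E size_mulX //.
by apply: contraNneq Qji => Q10; rewrite Q_root -Q1E Q10 mul0r.
Qed.

Lemma specialization_algebraic (z : fps {poly K}) (Q : {poly {poly {poly K}}}) :
  Q != 0 -> (map_poly phi Q).[z] = 0 ->
  algebraic_ps (powerSeries_of_fps (fps_map ev0 z)).
Proof.
move=> Q0 /(divide_out_X Q0)[{Q0}Q Q0 Qz]; exists (map_poly (map_poly ev0) Q) => //.
apply/rootP.
have -> : map_poly (@ps_of_poly K) (map_poly (map_poly ev0) Q)
    = map_poly (powerSeries_of_fps \o fps_map ev0) (map_poly phi Q).
  apply/polyP => i; rewrite [RHS]coef_map coef_map_id0; last first.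
    by apply/funext => n; rewrite /ps_of_poly coef0.
  by rewrite !coef_map; rewrite [RHS]/= fps_map_poly.
rewrite -[X in _.[X]]/((powerSeries_of_fps \o fps_map ev0) z) horner_map Qz.
exact: rmorph0.
Qed.

(** The components of the solution of a polynomial system with zero constant
    terms and rank-decreasing unary rules are algebraic, and so are their
    sums. *)
Theorem algebraic_system (C : finType) (rl : seq (C * seq C)) (T I : pred C)
    (rk : C -> nat) (F : C -> fps K) :
  (forall q, q \in rl ->
    q.2 != [::] /\ forall b, q.2 = [:: b] -> (rk b < rk q.1)%N) ->
  (forall a, F a 0%N = 0) ->
  (forall a, F a = fps_of_poly ((T a)%:R *: 'X)
     + \sum_(q <- rl | q.1 == a) \prod_(b <- q.2) F b) ->
  algebraic_ps (powerSeries_of_fps (\sum_(a | I a) F a)).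
Proof.
move=> rl_graded F0 F_sys.
pose N := (\max_(q <- rl) size q.2).+2.
have rl_small q : q \in rl -> (size q.2 < N)%N.
  by move=> q_rl; rewrite ltnW // !ltnS; apply: leq_bigmax_seq.
pose wt (L : comNzRingType) := [seq ((1 : L), q) | q <- rl].
have graded (L : comNzRingType) (c : L) : graded_rules (perturbed_rules (wt L) N c) rk.
  move=> q; rewrite mem_cat => /orP[|] /mapP[q' q'_in ->] /=; first exact: rl_graded.
  by split.
have [y y0 y_sys] := system_exists T (graded {poly K} 'X).
(* the extra rules have weight 0 after the specialization s = 0 *)
have Fy a : F a = fps_map ev0 (y a).
  apply: (@system_unique _ _ _ T _ (graded K 0) F (fun b => fps_map ev0 (y b))) => //.
  - by move=> b; rewrite /fps_map y0 rmorph0.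
  - move=> b; rewrite F_sys /system big_cat !big_map /=.
    rewrite [X in _ + (_ + X)]big1 => [|c _]; last by rewrite polyC0 rmorph0 mul0r.
    rewrite addr0; congr (_ + _); apply: eq_bigr => q _.
    by rewrite polyC1 rmorph1 mul1r.
  move=> b; rewrite -[in RHS]y_sys /system rmorphD /= fps_map_poly.
  rewrite map_polyZ rmorph_nat map_polyX; congr (_ + _).
  rewrite rmorph_sum !big_cat !big_map /=.
  congr (_ + _); apply: eq_bigr => q _; rewrite rmorphM rmorph_prod /= fps_map_poly.
    by rewrite !polyC1 !rmorph1.
  by rewrite map_polyC /= /horner_eval hornerX.
have [||||Q Q0 Qz] := @perturbed_algebraic _ C (wt {poly K}) T N 'X _ _ _ y _ I.
- by [].
- by move=> q /mapP[q' /rl_small ? ->].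
- by rewrite polyX_eq0.
- exact: y_sys.
have := specialization_algebraic Q0 Qz.
by rewrite rmorph_sum (eq_bigr F) // => a _; rewrite Fy.
Qed.

End Specialization.

(** * Complete composition in a colored operad *)

Lemma onth_size_cat (T : Type) (w1 : seq T) b (w2 : seq T) :
  onth (w1 ++ b :: w2) (size w1) = Some b.
Proof. by rewrite onth_cat ltnn subnn. Qed.

Section FullComposition.
Variables (C : finType) (O : coloredOperad C).
Implicit Types (x y z : O) (w : seq C) (zs qs : seq O).

Local Notation outs zs := (map (@op_out C O) zs).

(** The concatenation of the input words of the elements of [zs]. *)
Definition leaves zs : seq C := flatten (map (@op_in C O) zs).

Lemma full_comp_from_out_in x w1 ys w2 :
  op_in x = w1 ++ outs ys ++ w2 ->
  op_out (full_comp_from x (size w1) ys) = op_out x /\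
  op_in (full_comp_from x (size w1) ys) = w1 ++ leaves ys ++ w2.
Proof.
elim: ys w1 => [|y ys IH] w1 //= ex.
have [] := IH (rcons w1 (op_out y)); first by rewrite cat_rcons.
rewrite size_rcons cat_rcons => eo ei.
have pos : onth (op_in (full_comp_from x (size w1).+1 ys)) (size w1)
    = Some (op_out y) by rewrite ei onth_size_cat.
by rewrite op_out_comp // op_in_comp // ei splice_cat // /leaves /= -!catA.
Qed.

Lemma full_comp_from_cat x i ys1 ys2 :
  full_comp_from x i (ys1 ++ ys2)
  = full_comp_from (full_comp_from x (i + size ys1) ys2) i ys1.
Proof.
elim: ys1 i => [|y ys1 IH] i /=; first by rewrite addn0.
by rewrite IH addSnnS.
Qed.

Lemma full_comp_from_seqA x z w1 w2 v1 qs v2 :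
  op_in x = w1 ++ op_out z :: w2 -> op_in z = v1 ++ outs qs ++ v2 ->
  full_comp_from (op_comp x (size w1) z) (size w1 + size v1) qs
  = op_comp x (size w1) (full_comp_from z (size v1) qs).
Proof.
move=> ex; elim: qs v1 => [|q qs IH] v1 //= ez.
have ez' : op_in z = rcons v1 (op_out q) ++ outs qs ++ v2 by rewrite cat_rcons.
have [eo ei] := full_comp_from_out_in ez'.
rewrite size_rcons in eo ei.
rewrite -addnS; have := IH _ ez'; rewrite size_rcons => ->.
rewrite op_comp_seqA // ?ei ?cat_rcons ?onth_size_cat //.
by rewrite ex eo onth_size_cat.
Qed.

Lemma full_comp_from_parA x z w1 w2 qs w3 :
  op_in x = w1 ++ op_out z :: w2 ++ outs qs ++ w3 ->
  full_comp_from (op_comp x (size w1) z)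
    (size w1 + size (op_in z) + size w2) qs
  = op_comp (full_comp_from x (size w1 + size w2).+1 qs) (size w1) z.
Proof.
elim: qs w2 => [|q qs IH] w2 //= ex.
have := IH (rcons w2 (op_out q)); rewrite cat_rcons size_rcons !addnS => -> //.
set p := full_comp_from _ _ _.
have [_ ep] : op_out p = op_out x /\ op_in p
    = w1 ++ op_out z :: w2 ++ op_out q :: leaves qs ++ w3.
  have := @full_comp_from_out_in x (w1 ++ op_out z :: rcons w2 (op_out q)) qs w3.
  rewrite size_cat /= size_rcons !addnS -!catA /= !cat_rcons; exact.
have -> : (size w1 + size (op_in z) + size w2
          = ((size w1 + size w2).+1 + size (op_in z)).-1)%N by lia.
rewrite op_comp_parA //; first by lia.
  by rewrite ep onth_size_cat.
rewrite ep; have -> : (size w1 + size w2).+1 = size (w1 ++ op_out z :: w2).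
  by rewrite size_cat /= addnS.
by rewrite -cat_cons catA onth_size_cat.
Qed.

(** Cuts [qs] into consecutive blocks of lengths [arity z_1, ..., arity z_k],
    where [zs = [:: z_1; ...; z_k]], and composes [z_i] with the i-th block. *)
Fixpoint comps zs qs : seq O :=
  if zs is z :: zs' then
    full_comp z (take (arity z) qs) :: comps zs' (drop (arity z) qs)
  else [::].

Lemma full_comp_fromA v w1 zs w2 qs :
  op_in v = w1 ++ outs zs ++ w2 -> outs qs = leaves zs ->
  full_comp_from (full_comp_from v (size w1) zs) (size w1) qs
  = full_comp_from v (size w1) (comps zs qs).
Proof.
elim: zs w1 qs => [|z zs IH] w1 qs ev.
  by move=> /(congr1 size); rewrite size_map => /size0nil ->.
rewrite /leaves /= -/(leaves zs) => eqs.
set q1 := take _ _; set q2 := drop _ _.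
have sz1 : size q1 = arity z.
  rewrite size_take -(size_map (@op_out C O)) eqs size_cat /arity.
  by case: ltnP => //; lia.
have [eq1 eq2] : outs q1 = op_in z /\ outs q2 = leaves zs.
  by rewrite map_take map_drop eqs take_size_cat // drop_size_cat.
have ev' : op_in v = rcons w1 (op_out z) ++ outs zs ++ w2 by rewrite cat_rcons.
have [po pi] := full_comp_from_out_in ev'; rewrite size_rcons cat_rcons in po pi.
rewrite -(cat_take_drop (arity z) qs) -/q1 -/q2 full_comp_from_cat sz1.
have := @full_comp_from_parA (full_comp_from v (size w1).+1 zs) z w1 [::] q2 w2.
rewrite /= !addn0 /arity => ->; last by rewrite pi eq2.
have := IH _ q2 ev' eq2; rewrite size_rcons => IHp.
rewrite -IHp; set p := full_comp_from _ _ q2.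
have [_ ip] : op_out p = op_out v /\ op_in p = w1 ++ op_out z :: leaves q2 ++ w2.
  have := @full_comp_from_out_in (full_comp_from v (size w1).+1 zs)
    (rcons w1 (op_out z)) q2 w2.
  by rewrite size_rcons !cat_rcons eq2 po; apply.
have := @full_comp_from_seqA p z w1 (leaves q2 ++ w2) [::] q1 [::] ip.
by rewrite /= addn0 cats0 eq1 => ->.
Qed.

Lemma outs_comps zs qs : outs qs = leaves zs -> outs (comps zs qs) = outs zs.
Proof.
elim: zs qs => //= z zs IH qs; rewrite /leaves /= -/(leaves zs) => eqs.
rewrite IH ?map_drop ?eqs ?drop_size_cat //; congr (_ :: _).
suff ez : full_composable z (take (arity z) qs).
  case: (@full_comp_from_out_in z [::] (take (arity z) qs) [::]) => //.
  by rewrite ez cats0.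
by rewrite /full_composable map_take eqs take_size_cat.
Qed.

(** Associativity: v[zs][qs] = v[z_1[qs_1], ..., z_k[qs_k]]. *)
Lemma full_compA v zs qs : full_composable v zs -> outs qs = leaves zs ->
  full_comp (full_comp v zs) qs = full_comp v (comps zs qs).
Proof.
move=> ev eqs.
by apply: (@full_comp_fromA v [::] zs [::] qs); rewrite // cats0.
Qed.

Lemma full_comp_out v zs : full_composable v zs ->
  op_out (full_comp v zs) = op_out v.
Proof.
by move=> ev; case: (@full_comp_from_out_in v [::] zs [::]); rewrite ?cats0.
Qed.

Lemma full_comp_in v zs : full_composable v zs ->
  op_in (full_comp v zs) = leaves zs.
Proof.
by move=> ev; case: (@full_comp_from_out_in v [::] zs [::]); rewrite ?cats0.
Qed.

Lemma full_comp1x x : full_comp (op_unit O (op_out x)) [:: x] = x.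
Proof. exact: op_comp1x. Qed.

(** The word of units with colors [w]. *)
Definition units w : seq O := map (op_unit O) w.

Lemma outs_units w : outs (units w) = w.
Proof. by rewrite -map_comp map_id_in // => a _; rewrite /= op_out_unit. Qed.

Lemma full_comp_from_units x w1 w w2 : op_in x = w1 ++ w ++ w2 ->
  full_comp_from x (size w1) (units w) = x.
Proof.
elim: w w1 => [|a w IH] w1 //= ex.
have := IH (rcons w1 a); rewrite cat_rcons size_rcons => -> //.
by rewrite op_compx1 // ex onth_size_cat.
Qed.

Lemma full_compx1 x : full_comp x (units (op_in x)) = x.
Proof. by apply: (@full_comp_from_units x [::] _ [::]); rewrite cats0. Qed.

Lemma op_comp_full x w1 r w2 : op_in x = w1 ++ op_out r :: w2 ->
  op_comp x (size w1) r = full_comp x (units w1 ++ r :: units w2).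
Proof.
move=> ex; rewrite /full_comp full_comp_from_cat add0n size_map /=.
have := @full_comp_from_units x (rcons w1 (op_out r)) w2 [::].
rewrite cats0 cat_rcons size_rcons => -> //.
rewrite (@full_comp_from_units _ [::] _ (op_in r ++ w2)) //.
by rewrite op_in_comp ex ?onth_size_cat // splice_cat.
Qed.

Lemma arity_gt0 x : (0 < arity x)%N.
Proof. exact: op_in_gt0. Qed.

Lemma arity_full_comp v zs : full_composable v zs ->
  arity (full_comp v zs) = \sum_(z <- zs) arity z.
Proof.
move=> ev; rewrite /arity full_comp_in // size_flatten /shape -map_comp.
by rewrite sumnE big_map.
Qed.

End FullComposition.

(** * The composition product *)

Section CompositionProduct.
Variables (C : finType) (O : coloredOperad C).
Hypothesis O_lf : locally_finite O.
Implicit Types (x y z : O) (w : seq C) (zs qs : seq O).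

Local Notation outs zs := (map (@op_out C O) zs).

Lemma finite_arity_le n : finite_set [set x : O | (arity x <= n)%N].
Proof.
apply: (@sub_finite_set _ _ (\bigcup_(k in `I_n.+1) [set x : O | arity x = k])).
  by move=> x /= le_xn; exists (arity x).
by apply: bigcup_finite => // k _; apply: O_lf.
Qed.

(** All the elements of arity at most [n]. *)
Definition elems n : seq O :=
  undup (projT1 (cid ((finite_seqP _).1 (finite_arity_le n)))).

Lemma elems_uniq n : uniq (elems n).
Proof. exact: undup_uniq. Qed.

Lemma mem_elems n x : (x \in elems n) = (arity x <= n)%N.
Proof.
rewrite mem_undup; case: cid => s /= es; apply/idP/idP => [xs|le_x].
  by have : [set` s] x by []; rewrite -es.
by have : [set x : O | (arity x <= n)%N] x by []; rewrite es.
Qed.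

Section Bounded.
Variable n : nat.

(** All the sequences of elements of arity at most [n] with output colors
    [w]. *)
Fixpoint words w : seq (seq O) :=
  if w is a :: w' then
    [seq z :: zs | z <- [seq z <- elems n | op_out z == a], zs <- words w']
  else [:: [::]].

Lemma words_uniq w : uniq (words w).
Proof.
elim: w => //= a w IH; apply: allpairs_uniq => //.
  by rewrite filter_uniq ?elems_uniq.
by move=> [z1 zs1] [z2 zs2] _ _ /= [-> ->].
Qed.

Lemma mem_words w zs : (zs \in words w) =
  (outs zs == w) && all (fun z => arity z <= n)%N zs.
Proof.
elim: w zs => [|a w IH] [|z zs] //=; first by apply/allpairsP => -[[? ?] []].
apply/allpairsP/idP => [[[z' zs'] /= []]|].
  rewrite mem_filter mem_elems => /andP[/eqP <- le_z].
  by rewrite IH => /andP[/eqP <- all_zs] [-> ->]; rewrite eqxx le_z.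
rewrite eqseq_cons => /and3P[/andP[/eqP ea ew] le_z all_zs].
exists (z, zs); split=> //; first by rewrite mem_filter mem_elems ea eqxx.
by rewrite IH ew.
Qed.

Lemma outs_words w zs : zs \in words w -> outs zs = w.
Proof. by rewrite mem_words => /andP[/eqP]. Qed.

Lemma decomp_mem y zs :
  full_composable y zs -> (arity (full_comp y zs) <= n)%N ->
  y \in elems n /\ zs \in words (op_in y).
Proof.
move=> eyzs le_n; split.
  rewrite mem_elems; apply: leq_trans le_n.
  have -> : arity y = size zs by rewrite /arity -eyzs size_map.
  rewrite arity_full_comp // -sum1_size; apply: leq_sum => z _.
  exact: arity_gt0.
rewrite mem_words eyzs eqxx; apply/allP => z z_zs.
by apply: leq_trans le_n; rewrite arity_full_comp // (big_rem z) //= leq_addr.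
Qed.

Variable K : fieldType.
Implicit Types (f g h : O -> K) (Psi : seq O -> K).

(** The sum of [(prod_i g z_i) * Psi [:: z_1; ...; z_k]] over the sequences in
    [words w]; it turns the composition product into iterated finite sums. *)
Definition wsum g w Psi : K :=
  \sum_(zs <- words w) (\prod_(z <- zs) g z) * Psi zs.

Lemma wsum_nil g Psi : wsum g [::] Psi = Psi [::].
Proof. by rewrite /wsum big_seq1 big_nil mul1r. Qed.

Lemma wsum_cons g a w Psi : wsum g (a :: w) Psi =
  \sum_(z <- elems n | op_out z == a) g z * wsum g w (fun zs => Psi (z :: zs)).
Proof.
rewrite /wsum /= big_allpairs_dep big_filter; apply: eq_bigr => z _.
by rewrite mulr_sumr; apply: eq_bigr => zs _; rewrite big_cons mulrA.
Qed.

Lemma eq_wsum g w Psi1 Psi2 :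
  (forall zs, zs \in words w -> Psi1 zs = Psi2 zs) ->
  wsum g w Psi1 = wsum g w Psi2.
Proof.
by move=> eqP; rewrite /wsum !big_seq; apply: eq_bigr => zs /eqP ->.
Qed.

Lemma wsum0 g w Psi : (forall zs, zs \in words w -> Psi zs = 0) ->
  wsum g w Psi = 0.
Proof.
by move=> Psi0; rewrite /wsum big_seq big1 // => zs /Psi0 ->; rewrite mulr0.
Qed.

Lemma wsum_cat g w1 w2 Psi : wsum g (w1 ++ w2) Psi =
  wsum g w1 (fun zs1 => wsum g w2 (fun zs2 => Psi (zs1 ++ zs2))).
Proof.
elim: w1 Psi => [|a w1 IH] Psi; first by rewrite wsum_nil.
by rewrite /= !wsum_cons; apply: eq_bigr => z _; rewrite IH.
Qed.

Lemma wsum_sum g w I (r : seq I) (P : pred I) (Psi : I -> seq O -> K) :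
  wsum g w (fun zs => \sum_(i <- r | P i) Psi i zs) =
  \sum_(i <- r | P i) wsum g w (Psi i).
Proof.
rewrite /wsum exchange_big; apply: eq_bigr => zs _.
by rewrite mulr_sumr.
Qed.

Lemma wsumZ g w Psi c : wsum g w (fun zs => c * Psi zs) = c * wsum g w Psi.
Proof. by rewrite mulr_sumr; apply: eq_bigr => zs _; rewrite mulrCA. Qed.

Lemma comp_prodE f g x : (arity x <= n)%N -> comp_prod f g x =
  \sum_(y <- elems n) f y * wsum g (op_in y) (fun zs => (full_comp y zs == x)%:R).
Proof.
move=> le_xn.
pose r := [seq p <- [seq (y, zs) | y <- elems n, zs <- words (op_in y)] |
             full_comp p.1 p.2 == x].
transitivity (\sum_(p <- r) f p.1 * \prod_(z <- p.2) g z); last first.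
  rewrite big_filter big_mkcond big_allpairs_dep; apply: eq_bigr => y _.
  rewrite mulr_sumr; apply: eq_bigr => zs _ /=.
  by case: eqP => _; rewrite ?mulr1 ?mulr0.
rewrite fsbig_seq; last first.
  rewrite filter_uniq // allpairs_uniq_dep ?elems_uniq // => [y _|].
    exact: words_uniq.
  by move=> [y zs] [y' zs'] _ _ /= [-> ->].
apply: eq_fsbigl; apply/funext => -[y zs]; apply/propext.
change (full_composable y zs /\ x = full_comp y zs <-> (y, zs) \in r).
rewrite mem_filter /=; split=> [[eyzs ex]|/andP[/eqP <-]].
  have [|y_elems zs_words] := decomp_mem eyzs; first by rewrite -ex.
  by rewrite -ex eqxx; apply/allpairsPdep; exists y, zs.
case/allpairsPdep => y' [zs' [_ + [-> ->]]] => /outs_words eyzs.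
by split.
Qed.

End Bounded.


Variable K : fieldType.
Implicit Types f g h : O -> K.

Lemma sum_elems_delta n (P : pred O) (J : O -> K) v :
  \sum_(p <- elems n | P p) (v == p)%:R * J p
  = if (arity v <= n)%N && P v then J v else 0.
Proof.
case: ifP => [/andP[le_v Pv]|]; last first.
  move=> nv; rewrite big_seq_cond big1 // => p /andP[]; rewrite mem_elems => le_p Pp.
  by case: eqP => [ev|]; [rewrite ev le_p Pp in nv | rewrite mul0r].
rewrite big_mkcond (bigD1_seq v) ?elems_uniq ?mem_elems //= eqxx mul1r Pv.
rewrite big1 ?addr0 // => p ne.
by rewrite eq_sym (negPf ne) mul0r if_same.
Qed.

Lemma wsum_exchange n g h w w' (Psi : seq O -> seq O -> K) :
  wsum n h w' (fun qs => wsum n g w (fun zs => Psi zs qs)) =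
  wsum n g w (fun zs => wsum n h w' (fun qs => Psi zs qs)).
Proof.
rewrite /wsum.
under eq_bigr => qs _ do rewrite mulr_sumr.
rewrite exchange_big; apply: eq_bigr => zs _.
by rewrite mulr_sumr; apply: eq_bigr => qs _; rewrite mulrCA.
Qed.

(** Expanding each factor [comp_prod g h] amounts to summing over the pairs
    (zs, qs) where [qs] fills all the inputs of [zs]. *)
Lemma wsum_comp n g h w (Psi : seq O -> K) :
  (forall ps, outs ps = w -> ~~ all (fun p => arity p <= n)%N ps -> Psi ps = 0) ->
  wsum n (comp_prod g h) w Psi =
  wsum n g w (fun zs => wsum n h (leaves zs) (fun qs => Psi (comps zs qs))).
Proof.
elim: w Psi => [|a w IH] Psi Psi0; first by rewrite !wsum_nil.
rewrite !wsum_cons.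
pose J p := wsum n g w (fun zs => wsum n h (leaves zs) (fun qs => Psi (p :: comps zs qs))).
have J0 p : op_out p = a -> (n < arity p)%N -> J p = 0.
  rewrite ltnNge => ep lt_p; rewrite /J; apply: wsum0 => zs /outs_words ezs.
  apply: wsum0 => qs /outs_words eqs.
  by apply: Psi0; rewrite /= ?ep ?outs_comps ?ezs // negb_and lt_p.
transitivity (\sum_(p <- elems n | op_out p == a) \sum_(z <- elems n)
    g z * wsum n h (op_in z) (fun qs => (full_comp z qs == p)%:R * J p)).
  rewrite big_seq_cond [RHS]big_seq_cond; apply: eq_bigr => p /andP[].
  rewrite mem_elems => le_p /eqP ep.
  rewrite (comp_prodE _ _ le_p) mulr_suml; apply: eq_bigr => z _.
  rewrite -mulrA; congr (_ * _); rewrite IH => [|ps eps ps0]; last first.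
    by rewrite Psi0 //= ?ep ?eps // negb_and ps0 orbT.
  by rewrite mulrC -wsumZ; apply: eq_wsum => qs _; rewrite mulrC.
rewrite exchange_big [RHS]big_mkcond /=; apply: eq_bigr => z _.
rewrite -mulr_sumr -wsum_sum.
transitivity (g z * wsum n h (op_in z)
    (fun qs => if op_out z == a then J (full_comp z qs) else 0)).
  congr (_ * _); apply: eq_wsum => qs /outs_words eqs.
  rewrite sum_elems_delta full_comp_out //.
  case: eqP => [ez|_]; last by rewrite andbF.
  by case: leqP => //= /J0 -> //; rewrite full_comp_out.
case: eqP => _; last by rewrite wsum0 ?mulr0.
congr (_ * _); rewrite /J wsum_exchange; apply: eq_wsum => zs _.
rewrite /leaves /= -/(leaves zs) wsum_cat.
apply: eq_wsum => q1 /outs_words eq1; apply: eq_wsum => q2 _.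
have <- : size q1 = arity z by rewrite /arity -eq1 size_map.
by rewrite take_size_cat // drop_size_cat.
Qed.

Lemma comp_prodA f g h : comp_prod (comp_prod f g) h = comp_prod f (comp_prod g h).
Proof.
apply/funext => x; set n := arity x.
have le_xn : (arity x <= n)%N by [].
rewrite !(comp_prodE _ _ le_xn).
(* the coefficient at y of the series paired with f o g; it vanishes beyond
   arity n, so that restricting y to elems n loses nothing *)
pose H y := wsum n h (op_in y) (fun qs => (full_comp y qs == x)%:R).
have H0 y : (n < arity y)%N -> H y = 0.
  move=> lt_y; rewrite /H; apply: wsum0 => qs /outs_words eqs; case: eqP => // exy.
  move: lt_y; rewrite /n -exy ltnNge arity_full_comp //.
  have -> : arity y = size qs by rewrite /arity -eqs size_map.
  by rewrite -sum1_size leq_sum // => q _; apply: arity_gt0.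
transitivity (\sum_(y <- elems n) \sum_(v <- elems n)
    f v * wsum n g (op_in v) (fun zs => (full_comp v zs == y)%:R * H y)).
  rewrite !big_seq; apply: eq_bigr => y; rewrite mem_elems => le_y.
  rewrite (comp_prodE _ _ le_y) mulr_suml; apply: eq_bigr => v _.
  rewrite -mulrA; congr (_ * _); rewrite mulrC -wsumZ.
  by apply: eq_wsum => zs _; rewrite mulrC.
rewrite exchange_big /=; apply: eq_bigr => v _.
rewrite -mulr_sumr -wsum_sum; congr (_ * _); rewrite wsum_comp; last first.
  move=> ps eps /allPn[p p_ps]; rewrite -ltnNge => lt_p.
  case: eqP => // ex; move: lt_p; rewrite /n -ex ltnNge arity_full_comp //.
  by rewrite (big_rem p) //= leq_addr.
apply: eq_wsum => zs /outs_words ezs.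
rewrite (sum_elems_delta _ predT) andbT.
transitivity (H (full_comp v zs)); first by case: leqP => // /H0 ->.
rewrite /H full_comp_in //; apply: eq_wsum => qs /outs_words eqs.
by rewrite full_compA.
Qed.



Local Notation u := (unit_series K : O -> K).

Lemma arity_unit a : arity (op_unit O a) = 1%N.
Proof. by rewrite /arity op_in_unit. Qed.

(** The characteristic series of the units with color in [A]; for the set of
    all colors this is the unit series. *)
Definition color_series (A : set C) : O -> K := char_series K (op_unit O @` A).

Lemma wsum_color_series (A : set C) n w Psi : (0 < n)%N ->
  wsum n (color_series A) w Psi = (all (mem A) w)%:R * Psi (units O w).
Proof.
move=> n_gt0; elim: w Psi => [|a w IH] Psi; first by rewrite wsum_nil mul1r.
rewrite wsum_cons big_mkcond (bigD1_seq (op_unit O a)) ?elems_uniq ?mem_elems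
  ?arity_unit //=.
rewrite op_out_unit eqxx IH mulrA -mulnb natrM big1 => [|z ne].
  rewrite addr0; congr (_ * _ * _); rewrite /color_series /char_series; congr _%:R.
  congr nat_of_bool; apply/idP/idP => [/set_mem[b Ab]|/set_mem Aa].
    move=> /(congr1 (@op_out C O)); rewrite !op_out_unit => <-.
    exact: mem_set.
  by apply: mem_set; exists a.
case: eqP => // ea; rewrite /color_series /char_series memNset ?mul0r // => -[b _ eb].
by move: ne; rewrite -ea -eb op_out_unit eqxx.
Qed.

Lemma comp_prod_color_seriesr (A : set C) f x :
  comp_prod f (color_series A) x = (all (mem A) (op_in x))%:R * f x.
Proof.
rewrite (comp_prodE _ _ (leqnn _)).
rewrite (bigD1_seq x) ?elems_uniq ?mem_elems //= wsum_color_series ?arity_gt0 //.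
rewrite full_compx1 eqxx mulr1 mulrC big1 ?addr0 // => y ne.
by rewrite wsum_color_series ?arity_gt0 // full_compx1 (negPf ne) !mulr0.
Qed.

Lemma comp_prod_color_seriesl (A : set C) f x :
  comp_prod (color_series A) f x = (op_out x \in A)%:R * f x.
Proof.
rewrite (comp_prodE _ _ (leqnn _)).
have unit_elems : op_unit O (op_out x) \in elems (arity x).
  by rewrite mem_elems arity_unit arity_gt0.
have wsum1 a : wsum (arity x) f (op_in (op_unit O a))
    (fun zs => (full_comp (op_unit O a) zs == x)%:R) = (op_out x == a)%:R * f x.
  rewrite op_in_unit wsum_cons.
  transitivity (\sum_(z <- elems (arity x) | op_out z == a) (x == z)%:R * f z).
    apply: eq_bigr => z /eqP <-.
    by rewrite wsum_nil full_comp1x mulrC eq_sym.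
  by rewrite sum_elems_delta leqnn /=; case: eqP; rewrite ?mul1r ?mul0r.
rewrite (bigD1_seq _ unit_elems) ?elems_uniq //= wsum1 eqxx mul1r.
rewrite big1 ?addr0 => [|y ne].
  rewrite /color_series /char_series; congr (_%:R * _); congr nat_of_bool.
  apply/idP/idP => [/set_mem[b Ab]|/set_mem Aa].
    move=> /(congr1 (@op_out C O)); rewrite !op_out_unit => <-.
    exact: mem_set.
  by apply: mem_set; exists (op_out x).
have [[b _ eb]|ny] := pselect ((op_unit O @` A) y).
  rewrite -eb wsum1; case: eqP => [ex|_]; last by rewrite mul0r mulr0.
  by rewrite -eb -ex eqxx in ne.
by rewrite /color_series /char_series memNset ?mul0r.
Qed.

Lemma comp_prod1 f : comp_prod u f = f.
Proof.
apply/funext => x; rewrite (comp_prod_color_seriesl [set: C]).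
by rewrite in_setT mul1r.
Qed.

Lemma comp_prodr1 f : comp_prod f u = f.
Proof.
apply/funext => x; rewrite (comp_prod_color_seriesr [set: C]).
by rewrite (_ : all _ _) ?mul1r //; apply/allP => c _; apply: in_setT.
Qed.

Lemma comp_prodBl f g h :
  comp_prod (f \- g) h = comp_prod f h \- comp_prod g h.
Proof.
apply/funext => x; rewrite /= !(comp_prodE _ _ (leqnn _)) -sumrB.
by apply: eq_bigr => y _; rewrite mulrBl.
Qed.

Lemma comp_prodDl f g h :
  comp_prod (f \+ g) h = comp_prod f h \+ comp_prod g h.
Proof.
apply/funext => x; rewrite /= !(comp_prodE _ _ (leqnn _)) -big_split.
by apply: eq_bigr => y _; rewrite mulrDl.
Qed.

(** ** The inverse of u - r *)

Variables (S : set O) (rk : C -> nat).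
Hypothesis S_rk :
  forall r b, S r -> op_in r = [:: b] -> (rk b < rk (op_out r))%N.

Local Notation r := (char_series K S).

(** Lexicographic in the arity and the rank of the output color. *)
Definition weight x : nat := (arity x * (\max_a rk a).+1 + rk (op_out x))%N.

Lemma weight_comp y zs z : S y -> full_composable y zs -> z \in zs ->
  (weight z < weight (full_comp y zs))%N.
Proof.
move=> Sy eyzs z_zs; rewrite /weight full_comp_out // arity_full_comp //.
have := leq_bigmax (F := rk) (op_out z).
case: zs eyzs z_zs => [|z1 [|z2 zs]] // eyzs.
  rewrite inE => /eqP ez; rewrite big_seq1 -ez ltn_add2l => _; apply: (S_rk Sy).
  by rewrite -eyzs ez.
move=> z_zs le_rk.
suff lt_z : (arity z < \sum_(z <- [:: z1, z2 & zs]) arity z)%N.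
  apply: (@leq_trans ((arity z).+1 * (\max_a rk a).+1)).
    by rewrite mulSn addnC ltn_add2r ltnS.
  by rewrite (leq_trans _ (leq_addr _ _)) // leq_mul.
rewrite (perm_big _ (perm_to_rem z_zs)) big_cons -[X in (X < _)%N]addn0 ltn_add2l.
have : size (rem z [:: z1, z2 & zs]) = (size zs).+1 by rewrite size_rem.
case: (rem _ _) => // q qs _; rewrite big_cons.
by rewrite (leq_trans (arity_gt0 q)) ?leq_addr.
Qed.

Let Phi c f x := c x + comp_prod r f x.

Lemma affine_ranked c : ranked weight (Phi c).
Proof.
move=> x f g eq_fg; congr (_ + _); rewrite !(comp_prodE _ _ (leqnn _)).
apply: eq_bigr => y _; rewrite /char_series.
have [Sy|nSy] := pselect (S y); last by rewrite memNset // !mul0r.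
congr (_ * _); rewrite /wsum !big_seq; apply: eq_bigr => zs /outs_words eyzs.
case: eqP => [ex|]; last by rewrite !mulr0.
congr (_ * _); rewrite !big_seq; apply: eq_bigr => z z_zs.
by apply: eq_fg; rewrite -ex; apply: weight_comp.
Qed.

Lemma affine_unique c f g :
  f = c \+ comp_prod r f -> g = c \+ comp_prod r g -> f = g.
Proof.
move=> ef eg; apply/funext/(ranked_fixpoint_unique (affine_ranked c)) => x.
  by rewrite {2}ef.
by rewrite {2}eg.
Qed.

(** The solution X of X = u + r o X counts the trees over [S] by evaluation;
    only this equation is used. *)
Lemma tree_series_exists : exists X, X = u \+ comp_prod r X.
Proof.
have [X eX] := ranked_fixpoint_exists (affine_ranked u) 0.
by exists X; apply/funext => x; rewrite -[LHS]eX.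
Qed.

Lemma comp_inv_tree_series X : X = u \+ comp_prod r X ->
  comp_inv (u \- r) = X.
Proof.
move=> eX.
have uniq g : comp_prod (u \- r) g = u -> g = X.
  rewrite comp_prodBl comp_prod1 => eg; apply: affine_unique eX.
  by apply/funext => x /=; rewrite -eg /= subrK.
have rinv : comp_prod (u \- r) X = u.
  by rewrite comp_prodBl comp_prod1; apply/funext => x /=; rewrite {1}eX /= addrK.
have linv : comp_prod X (u \- r) = u.
  apply: (affine_unique (c := u \- r)).
    by rewrite {1}eX comp_prodDl comp_prod1 comp_prodA.
  by apply/funext => x /=; rewrite comp_prodr1 subrK.
rewrite /comp_inv; case: xgetP => [g _ [/uniq]|/(_ X)] //.
by case.
Qed.

(** The elements that are values of trees over [S]. *)
Inductive generated : O -> Prop :=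
| generated_unit a : generated (op_unit O a)
| generated_comp y zs : S y -> full_composable y zs ->
    (forall z, z \in zs -> generated z) -> generated (full_comp y zs).

(** [v] is (the image of) a natural number which is positive iff [P] holds. *)
Definition counts (v : K) (P : Prop) :=
  exists2 k : nat, v = k%:R & (0 < k)%N <-> P.

Lemma counts_sum (I : eqType) (s : seq I) (F : I -> K) (P : I -> Prop) :
  (forall i, i \in s -> counts (F i) (P i)) ->
  counts (\sum_(i <- s) F i) (exists2 i, i \in s & P i).
Proof.
elim: s => [|i s IH] cF.
  by exists 0%N; rewrite ?big_nil //; split=> // -[].
rewrite big_cons; have [k -> k0] := cF i (mem_head _ _).
have [j j_s|l -> l0] := IH; first by apply: cF; rewrite inE j_s orbT.
exists (k + l)%N; first by rewrite natrD.
rewrite addn_gt0; split=> [/orP[/k0 Pi|/l0[j j_s Pj]]|[j]].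
- by exists i => //; apply: mem_head.
- by exists j => //; rewrite inE j_s orbT.
rewrite inE => /orP[/eqP-> /k0 -> //|j_s Pj]; apply/orP; right; apply/l0.
by exists j.
Qed.

Lemma counts_prod (I : eqType) (s : seq I) (F : I -> K) (P : I -> Prop) :
  (forall i, i \in s -> counts (F i) (P i)) ->
  counts (\prod_(i <- s) F i) (forall i, i \in s -> P i).
Proof.
elim: s => [|i s IH] cF; first by exists 1%N; rewrite ?big_nil.
rewrite big_cons; have [k -> k0] := cF i (mem_head _ _).
have [j j_s|l -> l0] := IH; first by apply: cF; rewrite inE j_s orbT.
exists (k * l)%N; first by rewrite natrM.
rewrite muln_gt0; split=> [/andP[/k0 Pi /l0 Ps] j|Ps].
  by rewrite inE => /orP[/eqP ->|/Ps].
apply/andP; split; first by apply/k0/Ps/mem_head.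
by apply/l0 => j j_s; apply: Ps; rewrite inE j_s orbT.
Qed.

Lemma counts_char (A : set O) x : counts (char_series K A x) (A x).
Proof.
exists (x \in A : nat); first by rewrite /char_series.
by rewrite lt0b; split; [move/set_mem|move/mem_set].
Qed.

Lemma countsM v1 v2 P1 P2 : counts v1 P1 -> counts v2 P2 ->
  counts (v1 * v2) (P1 /\ P2).
Proof.
move=> [k -> k0] [l -> l0]; exists (k * l)%N; first by rewrite natrM.
by rewrite muln_gt0; split=> [/andP[/k0 ? /l0]|[/k0 -> /l0 ->]].
Qed.

Lemma countsD v1 v2 P1 P2 : counts v1 P1 -> counts v2 P2 ->
  counts (v1 + v2) (P1 \/ P2).
Proof.
move=> [k -> k0] [l -> l0]; exists (k + l)%N; first by rewrite natrD.
rewrite addn_gt0; split=> [/orP[/k0|/l0]|[/k0 ->|/l0 ->]]; rewrite ?orbT //.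
  by left.
by right.
Qed.

Lemma countsW v P Q : counts v P -> (P <-> Q) -> counts v Q.
Proof. by move=> [k ek k0] PQ; exists k => //; rewrite k0. Qed.

Lemma tree_series_counts X : X = u \+ comp_prod r X ->
  forall x, counts (X x) (generated x).
Proof.
move=> eX x; have [m] := ubnP (weight x); elim: m x => // m IH x lt_xm.
rewrite eX /= (comp_prodE _ _ (leqnn _)).
have cu := counts_char (range (op_unit O)) x.
have cr : counts (\sum_(y <- elems (arity x)) r y * wsum (arity x) X (op_in y)
      (fun zs => (full_comp y zs == x)%:R))
    (exists2 y, y \in elems (arity x) &
       S y /\ exists2 zs, zs \in words (arity x) (op_in y) &
         full_comp y zs = x /\ forall z, z \in zs -> generated z).
  apply: counts_sum => y _.
  have [Sy|nSy] := pselect (S y); last first.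
    by exists 0%N; rewrite /char_series ?memNset ?mul0r //; split=> // -[].
  apply: countsM; first exact: counts_char.
  apply: counts_sum => zs /outs_words eyzs.
  case: eqP => [ex|ne]; last by exists 0%N; rewrite ?mulr0 //; split=> // -[].
  rewrite mulr1; apply: (countsW (counts_prod _)).
    move=> z z_zs; apply: IH; rewrite -ltnS; apply: leq_trans lt_xm.
    by rewrite ltnS -ex; apply: weight_comp.
  by split=> [|[]].
apply: countsW (countsD cu cr) _; split.
  case=> [[a _ <-]|[y _ [Sy [zs /outs_words eyzs [<- gen_zs]]]]].
    exact: generated_unit.
  exact: generated_comp.
case=> [a|y zs Sy eyzs gen_zs]; first by left; exists a.
right; have [y_e zs_w] := decomp_mem eyzs (leqnn _).
by exists y => //; split=> //; exists zs => //; split.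
Qed.

End CompositionProduct.

(** * Generating functions by output color *)

Section GeneratingFunctions.
Variables (C : finType) (O : coloredOperad C) (K : fieldType).
Hypothesis O_lf : locally_finite O.
Implicit Types (x y z : O) (w : seq C) (zs qs : seq O).

Local Notation outs zs := (map (@op_out C O) zs).
Local Notation elems := (elems O_lf).
Local Notation words := (words O_lf).
Local Notation wsum := (wsum O_lf).

Lemma generating_seriesE (A : set O) n : generating_series K A n =
  \sum_(x <- elems n | arity x == n) char_series K A x.
Proof.
pose s := [seq x <- elems n | (x \in A) && (arity x == n)].
rewrite /generating_series (@fsbigE _ _ _ _ _ s) => [||x|x] /=; last first.
- move=> /mem_set xA; rewrite mem_filter xA mem_elems /=.
  by case: eqP => // ->; rewrite leqnn.
- by rewrite mem_filter => /andP[/andP[/set_mem]].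
- by rewrite filter_uniq ?elems_uniq.
rewrite big_mkcond [RHS]big_mkcond big_filter [LHS]big_mkcond.
apply: eq_bigr => x _; rewrite /char_series.
have [xA|xA] := boolP (x \in A); last by case: ifP.
by case: eqP.
Qed.

Variables (X : O -> K) (T : pred C).

(** The generating function, weighted by [X], of the elements with output color
    [a] and all input colors in [T]. *)
Definition color_gf (a : C) : fps K := fun n =>
  \sum_(x <- elems n | (op_out x == a) && all T (op_in x) && (arity x == n)) X x.

(** The list of elements may be taken with any larger arity bound. *)
Lemma color_gfE a i n : (i <= n)%N -> color_gf a i =
  \sum_(x <- elems n | (op_out x == a) && all T (op_in x) && (arity x == i)) X x.
Proof.
move=> le_in; rewrite /color_gf -[LHS]big_filter -[RHS]big_filter.
apply: perm_big; apply: uniq_perm => [||x]; rewrite ?filter_uniq ?elems_uniq //.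
rewrite !mem_filter !mem_elems; case: (arity x =P i) => [->|_]; last by rewrite andbF.
by rewrite leqnn le_in.
Qed.

Lemma color_gf0 a : color_gf a 0%N = 0.
Proof. by apply: big1 => x /andP[_ /eqP x0]; have := arity_gt0 x; rewrite x0. Qed.

(** A product of generating functions enumerates words of elements by their
    total arity. *)
Lemma prod_color_gf n w m : (m <= n)%N ->
  wsum n X w (fun zs => ((\sum_(z <- zs) arity z == m)%N && all T (leaves zs))%:R)
  = (\prod_(b <- w) color_gf b) m.
Proof.
elim: w m => [|b w IH] m le_mn.
  by rewrite wsum_nil !big_nil andbT eq_sym.
rewrite wsum_cons big_cons fpsM.
transitivity (\sum_(z <- elems n | (op_out z == b) && all T (op_in z)) \sum_(i < m.+1)
    (arity z == i)%:R * (X z * (\prod_(b <- w) color_gf b) (m - i)%N));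
  last first.
  rewrite exchange_big; apply: eq_bigr => i _.
  rewrite (@color_gfE _ _ n); last by have := ltn_ord i; lia.
  rewrite mulr_suml [RHS]big_mkcondr; apply: eq_bigr => z _.
  by case: eqP; rewrite ?mul1r ?mul0r.
rewrite [RHS]big_mkcondr; apply: eq_bigr => z _.
case: ifP => [Tz|nTz]; last first.
  rewrite wsum0 ?mulr0 // => zs _.
  by rewrite /leaves /= all_cat nTz andbF.
have [le_zm|lt_mz] := leqP (arity z) m.
  rewrite (bigD1 (Ordinal (le_zm : (arity z < m.+1)%N))) //= eqxx mul1r.
  rewrite [X in _ + X]big1 ?addr0 => [|i ne]; last first.
    by case: eqP => [ei|_]; [case/eqP: ne; apply: val_inj | rewrite mul0r].
  rewrite -IH; last by lia.
  congr (_ * _); apply: eq_wsum => zs _; rewrite big_cons /leaves /= all_cat Tz /=.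
  by rewrite -(eqn_add2l (arity z) _ (m - _)) subnKC.
rewrite [RHS]big1 => [|i _]; last first.
  by case: eqP => [ei|_]; rewrite ?mul0r //; have := ltn_ord i; lia.
rewrite wsum0 ?mulr0 // => zs _; rewrite big_cons.
by case: eqP => // em; move: lt_mz; rewrite -em ltnNge leq_addr.
Qed.

Lemma prod_color_gf_small w n : (n < size w)%N ->
  (\prod_(b <- w) color_gf b) n = 0.
Proof.
elim: w n => // b w IH n lt_n; rewrite big_cons fpsM big1 // => i _.
case: (posnP i) => [->|i_gt0]; first by rewrite color_gf0 mul0r.
by rewrite IH ?mulr0 //; move: lt_n => /=; have := ltn_ord i; lia.
Qed.

Variables (S : set O) (rl : seq O).
Hypotheses (rl_uniq : uniq rl) (S_rl : S = [set` rl]).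
Hypothesis X_tree :
  X = (unit_series K : O -> K) \+ comp_prod (char_series K S) X.

Lemma color_gf_system a : color_gf a =
  fps_of_poly ((T a)%:R *: 'X)
  + \sum_(q <- [seq (op_out y, op_in y) | y <- rl] | q.1 == a)
      \prod_(b <- q.2) color_gf b.
Proof.
apply/funext => n; rewrite -[RHS]/(_ n + _ n) fps_sum big_map /=.
pose Q x := (op_out x == a) && all T (op_in x) && (arity x == n).
transitivity (\sum_(x <- elems n | Q x) ((unit_series K : O -> K) x
    + \sum_(y <- elems n) char_series K S y *
       wsum n X (op_in y) (fun zs => (full_comp y zs == x)%:R))).
  rewrite /color_gf -/Q big_seq_cond [RHS]big_seq_cond.
  apply: eq_bigr => x /andP[]; rewrite mem_elems => le_xn _.
  by rewrite [in LHS]X_tree /= (comp_prodE O_lf _ _ le_xn).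
rewrite big_split; congr (_ + _).
  transitivity (\sum_(x <- elems n | Q x) (op_unit O a == x)%:R * (1 : K)).
    apply: eq_bigr => x /andP[/andP[/eqP ex _] _]; rewrite mulr1.
    rewrite /unit_series /char_series; congr (_%:R); congr nat_of_bool.
    apply/idP/eqP => [/set_mem[b _]|<-]; last by apply: mem_set; exists a.
    by move=> eb; rewrite -ex -eb op_out_unit.
  rewrite (sum_elems_delta O_lf _ Q (fun=> 1)) /Q op_out_unit op_in_unit arity_unit.
  rewrite eqxx /= andbT /fps_of_poly coefZ coefX -natrM mulnb [n == 1%N]eq_sym.
  by case: (T a); case: eqP => [<-|]; rewrite ?andbF.
rewrite exchange_big /=.
transitivity (\sum_(y <- elems n | (y \in rl) && (op_out y == a))
   (\prod_(b <- op_in y) color_gf b) n).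
  rewrite [RHS]big_mkcond; apply: eq_bigr => y _; rewrite -mulr_sumr -wsum_sum.
  rewrite /char_series S_rl.
  have -> : (y \in [set` rl]) = (y \in rl).
    by apply/idP/idP => [/set_mem|y_rl]; last apply/mem_set.
  case: (y \in rl); rewrite ?mul0r // mul1r /=.
  transitivity (wsum n X (op_in y) (fun zs => if op_out y == a then
      ((\sum_(z <- zs) arity z == n)%N && all T (leaves zs))%:R else 0)).
    apply: eq_wsum => zs /outs_words eyzs.
    transitivity (\sum_(x <- elems n | Q x) (full_comp y zs == x)%:R * (1 : K)).
      by apply: eq_bigr => x _; rewrite mulr1.
    rewrite (sum_elems_delta O_lf _ Q (fun=> 1)) /Q full_comp_out // full_comp_in //.
    rewrite arity_full_comp //; case: (op_out y == a); rewrite ?andbF //=.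
    by case: eqP => [->|]; rewrite ?leqnn ?andbT ?andbF //; case: all.
  by case: eqP => _; [rewrite prod_color_gf | rewrite wsum0].
rewrite -[LHS]big_filter [RHS](bigID (fun y => arity y <= n)%N) /=.
rewrite [X in _ = _ + X]big1 => [|y /andP[_]]; last first.
  by rewrite -ltnNge => /prod_color_gf_small.
rewrite addr0 -[RHS]big_filter; apply: perm_big.
apply: uniq_perm => [||y]; rewrite ?filter_uniq ?elems_uniq //.
rewrite !mem_filter mem_elems.
by case: (y \in rl); case: (_ == a); case: (_ <= _)%N.
Qed.

End GeneratingFunctions.

(** * Derivations and generated elements *)

Section Derivations.
Variables (C : finType) (O : coloredOperad C) (S : set O).
Implicit Types (x y z : O) (w : seq C) (zs qs : seq O).

Local Notation outs zs := (map (@op_out C O) zs).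

Lemma mem_comps zs qs c : outs qs = leaves zs -> c \in comps zs qs ->
  exists z qs', [/\ z \in zs, full_composable z qs', {subset qs' <= qs} &
                    c = full_comp z qs'].
Proof.
elim: zs qs => //= z zs IH qs; rewrite /leaves /= -/(leaves zs) => eqs.
rewrite inE => /orP[/eqP ->|].
  exists z, (take (arity z) qs); split; rewrite ?mem_head //.
    by rewrite /full_composable map_take eqs take_size_cat.
  by move=> q; apply: mem_take.
case/IH => [|z' [qs' [z'_zs ez' sub ->]]].
  by rewrite map_drop eqs drop_size_cat.
exists z', qs'; split=> //; first by rewrite inE z'_zs orbT.
by move=> q /sub; apply: mem_drop.
Qed.

Lemma generated_full_comp x qs : generated S x -> full_composable x qs ->
  (forall q, q \in qs -> generated S q) -> generated S (full_comp x qs).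
Proof.
move=> gx; elim: gx qs => {x} [a|y zs Sy eyzs _ IH] qs.
  rewrite /full_composable op_in_unit; case: qs => [|q [|]] // [<-] gq.
  by rewrite full_comp1x; apply: gq; apply: mem_head.
rewrite /full_composable full_comp_in // => eqs gqs.
rewrite full_compA //; apply: generated_comp => //.
  by rewrite /full_composable outs_comps.
move=> c /(mem_comps eqs)[z [qs' [z_zs ez sub ->]]].
by apply: IH => // q /sub/gqs.
Qed.

Lemma generated_rule r : S r -> generated S r.
Proof.
move=> Sr; rewrite -(full_compx1 r); apply: generated_comp => //.
  by rewrite /full_composable outs_units.
by move=> z /mapP[a _ ->]; apply: generated_unit.
Qed.

Lemma generated_step x i r : generated S x -> S r -> composable x i r ->
  generated S (op_comp x i r).
Proof.
move=> gx Sr /(@onth_split C)[w1 [w2 [ex ->]]].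
rewrite (op_comp_full ex); apply: generated_full_comp => //.
  by rewrite /full_composable map_cat /= !outs_units.
move=> q; rewrite mem_cat inE => /or3P[/mapP[a _ ->]|/eqP->|/mapP[a _ ->]].
- exact: generated_unit.
- exact: generated_rule.
exact: generated_unit.
Qed.

Let derives x1 x2 :=
  exists r i, [/\ S r, composable x1 i r & x2 = op_comp x1 i r].

(** A tree is derived from its root: the rule at the root is grafted first,
    then the subtrees, from right to left. *)
Lemma generated_derives z : generated S z -> forall x i, composable x i z ->
  clos_refl_trans O derives x (op_comp x i z).
Proof.
elim=> {z} [a|y zs Sy eyzs _ IH] x i.
  by rewrite /composable op_out_unit => xi; rewrite op_compx1 //; apply: rt_refl.
rewrite /composable full_comp_out // => xi.
suff step w1 : op_in y = w1 ++ outs zs ->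
    clos_refl_trans O derives x (op_comp x i (full_comp_from y (size w1) zs)).
  exact: (step [::]).
elim: zs w1 {eyzs} IH => [|z zs IHzs] w1 IH /= ey.
  by apply: rt_step; exists y, i.
have ey' : op_in y = rcons w1 (op_out z) ++ outs zs ++ [::].
  by rewrite cats0 cat_rcons.
have [po pi] := full_comp_from_out_in ey'; rewrite size_rcons in po pi.
have pz : onth (op_in (full_comp_from y (size w1).+1 zs)) (size w1) = Some (op_out z).
  by rewrite pi cat_rcons onth_size_cat.
apply: (rt_trans _ _ _ (op_comp x i (full_comp_from y (size w1).+1 zs))).
  have := IHzs (rcons w1 (op_out z)); rewrite size_rcons; apply.
    by move=> q q_zs; apply: IH; rewrite inE q_zs orbT.
  by rewrite ey' cats0.
rewrite -op_comp_seqA ?po //; apply: IH; first exact: mem_head.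
rewrite /composable op_in_comp ?po //.
have [u1 [u2 [eu ->]]] := onth_split xi.
rewrite eu splice_cat // pi cat_rcons -catA catA -size_cat.
by rewrite onth_size_cat.
Qed.

Lemma derivableP a x :
  clos_refl_trans O derives (op_unit O a) x <-> generated S x /\ op_out x = a.
Proof.
split=> [der|[gx <-]]; last first.
  have := generated_derives gx (x := op_unit O (op_out x)) (i := 0).
  by rewrite op_comp1x; apply; rewrite /composable op_in_unit.
suff inv y z : clos_refl_trans O derives y z -> generated S y /\ op_out y = a ->
    generated S z /\ op_out z = a.
  by apply: inv der _; rewrite op_out_unit; split=> //; apply: generated_unit.
elim=> {y z der x} [y z [r [i [Sr yr ->]]]|//|x y z _ IH1 _ IH2 /IH1/IH2 //].
by move=> [gy <-]; rewrite op_out_comp //; split=> //; apply: generated_step.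
Qed.

End Derivations.

(** * The rank of colors *)

Section UnaryRank.
Variables (C : finType) (O : coloredOperad C).
Hypothesis O_lf : locally_finite O.
Variable S : set O.
Let unary : set O := [set r | S r /\ arity r = 1%N].
Hypothesis unary_ff : finitely_factorizes unary.

(** The number of nodes on the leftmost branch; all the trees considered are
    chains of unary nodes. *)
Fixpoint spine (t : tree O) : nat :=
  match t with
  | Node _ (t' :: _) => (spine t').+1
  | _ => 0%N
  end.

Lemma bigmax_mem (s : seq nat) : s != [::] -> (\max_(d <- s) d)%N \in s.
Proof.
elim: s => // d [|d' s] IH _; first by rewrite big_seq1 mem_head.
rewrite big_cons; have [_|_] := leqP d (\max_(j <- d' :: s) j).
  by rewrite inE IH ?orbT.
exact: mem_head.
Qed.

(** There are finitely many elements of arity 1, hence finitely many chains of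
    unary rules; the rank of [a] is the length of a longest chain with output
    color [a]. *)
Lemma unary_rank_exists : exists rk : C -> nat,
  forall r b, S r -> op_in r = [:: b] -> (rk b < rk (op_out r))%N.
Proof.
pose chains a := [set t | [/\ Free unary t, arity (ev t) = 1%N,
                             op_out (ev t) = a & tree_out t = a]].
have chains_fin a : finite_set (spine @` chains a).
  apply/finite_image/(@sub_finite_set _ _
    (\bigcup_(x in [set x : O | arity x = 1%N]) [set t | Free unary t /\ ev t = x])).
    by move=> t [Ft t1 _ _]; exists (ev t).
  by apply: bigcup_finite => // x _; apply: unary_ff.
have /choice[s sE] a : exists s : seq nat, spine @` chains a = [set` s].
  exact/finite_seqP.
exists (fun a => \max_(d <- s a) d)%N => r b Sr er.
have : (\max_(d <- s b) d)%N \in s b.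
  apply: bigmax_mem; apply/eqP => sb.
  have : [set` s b] 0%N.
    rewrite -sE; exists (Leaf O b) => //; split=> //=; first exact: Free_leaf.
      exact: arity_unit.
    exact: op_out_unit.
  by rewrite sb.
set m := (\max_(d <- s b) d)%N; move=> m_s.
have : [set` s b] m by [].
rewrite -sE => -[t [Ft t1 ot tt] et].
suff : [set` s (op_out r)] m.+1.
  by move=> m1_s; apply: (@leq_bigmax_seq _ (s (op_out r)) predT id m.+1).
have ert : full_composable r [:: ev t] by rewrite /full_composable /= ot er.
rewrite -sE; exists (Node r [:: t]); last by rewrite /= et.
split=> //=.
- apply: Free_node => /=; first by split=> //; rewrite /arity er.
    by rewrite tt er.
  by move=> t' [<-|[]].
- by rewrite arity_full_comp // big_seq1.
by rewrite full_comp_out.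
Qed.

End UnaryRank.

(** * The generating series of the language *)

Lemma Bud_locally_finite (C : finType) (O : operad) :
  locally_finite O -> locally_finite (Bud C O).
Proof.
move=> O_lf n.
have words_fin : finite_set [set u : seq C | size u = n].
  apply: (@sub_finite_set _ _ (@tval n C @` [set: n.-tuple C])).
    by move=> u /= eu; exists (tcast eu (in_tuple u)); rewrite // val_tcast.
  by apply: finite_image; apply: finite_finset.
pose triples := [set: C] `*` [set x : O | arity x = n] `*` [set u : seq C | size u = n].
have triples_fin : finite_set triples.
  by apply: finite_setX => //; apply: finite_setX => //; apply: O_lf.
apply: (@sub_finite_set _ _ (val @^-1` triples)).
  move=> p pn; have pu : arity (bud_op p) = n by rewrite -size_bud_in.
  by [].
by apply: finite_preimage => // p q _ _; apply: val_inj.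
Qed.

Theorem theorem3p3p13 (K : fieldType) (charK0 : [pchar K] =i pred0)
    (O : operad) (C : finType) (B : budGeneratingSystem O C)
    (O_lf : locally_finite O)
    (R1_ff : finitely_factorizes (unary_rules B))
    (B_unamb : unambiguous B K) :
  algebraic_ps (generating_series K (language B)).
Proof.
have Bud_lf := @Bud_locally_finite C O O_lf.
have [rk rules_rk] := unary_rank_exists Bud_lf R1_ff.
have [rl0 rulesE] := (finite_seqP _).1 (rules_finite B).
pose rl := undup rl0.
have {}rulesE : rules B = [set` rl].
  by rewrite rulesE; apply/seteqP; split=> y /=; rewrite mem_undup.
have [X X_tree] := tree_series_exists Bud_lf K rules_rk.
pose I := fun a => a \in initial_colors B.
pose T := fun a => a \in terminal_colors B.
have languageE x : language B x <->
    [/\ generated (rules B) x, I (op_out x) & all T (op_in x)].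
  split=> [[[a Ia /derivableP[gx ex]] xT]|[gx Ix /allP xT]].
    by split=> //; [rewrite ex; apply: mem_set|apply/allP => c /xT; apply: mem_set].
  split; last by move=> c /xT /set_mem.
  by exists (op_out x); [apply: set_mem | apply/derivableP].
have syntE x : synt B K x = (I (op_out x) && all T (op_in x))%:R * X x.
  rewrite /synt /unit_series /rules_series.
  rewrite (comp_prod_color_seriesr Bud_lf) (comp_prod_color_seriesl Bud_lf).
  rewrite (comp_inv_tree_series Bud_lf rules_rk X_tree).
  by rewrite mulrA -natrM mulnb andbC.
have synt_char x : synt B K x = (x \in language B)%:R.
  have [k Xk k_gt0] := tree_series_counts Bud_lf rules_rk X_tree x.
  have := B_unamb x; rewrite syntE; have [xIT|xIT] := boolP (I _ && _); last first.
    rewrite mul0r memNset // => /languageE[_ Ix xT].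
    by rewrite Ix xT in xIT.
  rewrite mul1r Xk => k01; have [kE|k0] := posnP k.
    rewrite memNset ?kE // => /languageE[gx _ _].
    by have := k_gt0.2 gx; rewrite kE.
  (* k > 0 is nonzero in K, hence its image is 1 *)
  case: k01 => [/eqP|->].
    by rewrite (pcharf0P K).1 // => /eqP kE; rewrite kE in k0.
  case/andP: xIT => Ix xT; rewrite mem_set //.
  by apply/languageE; split=> //; apply/k_gt0.
have graded q : q \in [seq (op_out y, op_in y) | y <- rl] ->
    q.2 != [::] /\ forall b, q.2 = [:: b] -> (rk b < rk q.1)%N.
  case/mapP => y y_rl ->; split=> [|b].
    by rewrite -size_eq0 -lt0n; apply: arity_gt0.
  by apply: rules_rk; rewrite rulesE.
have := algebraic_system I graded (color_gf0 Bud_lf X T)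
  (color_gf_system Bud_lf T (undup_uniq rl0) rulesE X_tree).
congr algebraic_ps; apply/esym/funext => n.
rewrite /powerSeries_of_fps fps_sum.
transitivity (\sum_(x <- elems Bud_lf n | arity x == n) synt B K x).
  by rewrite generating_seriesE; apply: eq_bigr => x _; rewrite synt_char.
under eq_bigr => x _ do rewrite syntE.
transitivity (\sum_(x <- elems Bud_lf n) \sum_(a | I a)
    if (op_out x == a) && all T (op_in x) && (arity x == n) then X x else 0).
  rewrite big_mkcond; apply: eq_bigr => x _.
  have [Ix|nIx] := boolP (I (op_out x)); last first.
    rewrite mul0r if_same big1 // => a Ia.
    by case: eqP => // ea; rewrite ea Ia in nIx.
  rewrite (bigD1 (op_out x)) //= eqxx big1 => [|a /andP[_ ne]]; last first.
    by rewrite eq_sym (negPf ne).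
  by rewrite addr0; case: all; case: eqP; rewrite ?mul1r ?mul0r.
rewrite exchange_big; apply: eq_bigr => a _.
by rewrite /color_gf -big_mkcond.
Qed.
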